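(* Let $n\ge1$ and let $c,d$ be complex parameters. The two sequences (indexed by $n$-tuples $\boldsymbol k$ of nonnegative integers) \begin{align*} \alpha_{\boldsymbol k}(a,b)&:=\prod_{1\le r<s\le n}\frac{\theta(ax_rx_sq^{k_r+k_s};p)}{\theta(ax_rx_s;p)}\prod_{r=1}^n\frac{\theta(ax_r^2q^{2k_r};p)}{\theta(ax_r^2;p)}\cdot\left(\frac ba\right)^{|\boldsymbol k|}q^{\sum_{r<s}k_rk_s}\\ &\quad\times\prod_{r,s=1}^n\frac{(ax_rx_s;q,p)_{k_r}}{(qx_r/x_s;q,p)_{k_r}}\prod_{r=1}^n\frac{(a^2x_rq/(bcd),\,cx_r,\,dx_r;q,p)_{k_r}}{(ax_rq/c,\,ax_rq/d,\,bcdx_r/a;q,p)_{k_r}}\prod_{r=1}^nx_r^{-k_r} \end{align*} and $$\beta_{\boldsymbol k}(a,b):=\frac{(bc/a,\,bd/a,\,aq/(cd);q,p)_{|\boldsymbol k|}\prod_{r=1}^n(bx_r;q,p)_{|\boldsymbol k|}}{\prod_{r,s=1}^n(qx_r/x_s;q,p)_{k_r}\prod_{r=1}^n(bcdx_r/a,\,ax_rq/c,\,ax_rq/d;q,p)_{k_r}}$$ form a WP Bailey pair with respect to the matrix $\mathbf B^{(5)}$.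
   Context: Let $q,p$ be complex numbers with $q\neq 0$ and $|p|<1$. For $a\ne 0$ put $\theta(a;p)=\prod_{j\ge 0}(1-ap^j)(1-p^{j+1}/a)$. For an integer $k$ the $q,p$-shifted factorial is $(a;q,p)_k=\prod_{j=0}^{k-1}\theta(aq^j;p)$ if $k\ge 0$ (empty product $=1$), and $(a;q,p)_{k}=\big(\prod_{j=k}^{-1}\theta(aq^{j};p)\big)^{-1}$ if $k<0$. Write $(a_1,\dots,a_m;q,p)_k=(a_1;q,p)_k\cdots(a_m;q,p)_k$. For a tuple $\boldsymbol k=(k_1,\dots,k_n)$, $|\boldsymbol k|=k_1+\cdots+k_n$; $\sum_{r<s}$ is over $1\le r<s\le n$. The $x_1,\dots,x_n$ are fixed complex parameters. All parameters are nonzero and generic in the sense that no denominators vanish. WP Bailey pair: given a matrix $\mathbf B=(B_{\boldsymbol k\boldsymbol j}(a,b))$ indexed by $n$-tuples of nonnegative integers, sequences $\alpha_{\boldsymbol N}(a,b)$ and $\beta_{\boldsymbol N}(a,b)$ form a WP Bailey pair with respect to $\mathbf B$ if for all $n$-tuples $\boldsymbol N$ of nonnegative integers $$\beta_{\boldsymbol N}(a,b)=\sum_{0\le j_r\le N_r,\ r=1,\dots,n}B_{\boldsymbol N\boldsymbol j}(a,b)\,\alpha_{\boldsymbol j}(a,b).$$ The matrix $\mathbf B^{(5)}$ has entries $$B^{(5)}_{\boldsymbol k\boldsymbol j}(a,b)=\frac{\prod_{1\le r<s\le n}(ax_rx_sq;q,p)_{k_r+k_s}\prod_{r=1}^n\big[(bq^{|\boldsymbol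 k|-k_r}/(ax_r);q,p)_{k_r-j_r}(bx_r;q,p)_{|\boldsymbol k|+j_r}\big]}{\prod_{r,s=1}^n\big[(q^{1+j_r-j_s}x_r/x_s;q,p)_{k_r-j_r}(ax_rx_sq;q,p)_{k_s+j_r}\big]}.$$ *)

(* Defs.v *)
From HB Require Import structures.
From mathcomp Require Export all_boot all_order all_algebra.
From mathcomp Require Export complex.
From mathcomp Require Export all_classical all_reals all_analysis.
Export numFieldNormedType.Exports.
Export Order.TTheory GRing.Theory Num.Theory.

Set Implicit Arguments.
Unset Strict Implicit.
Unset Printing Implicit Defensive.

Local Open Scope classical_set_scope.
Local Open Scope ring_scope.

(* The definitions are stated over an arbitrary numFieldType, because that is
   where the topology used by lim is attached; they are meant for C := R[i]. *)
Section Elliptic.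
Variable C : numFieldType.

(* For p = 0 the convention 0 ^+ 0 = 1 gives theta a 0 = 1 - a. *)
Definition theta (a p : C) : C :=
  lim ((fun m : nat => \prod_(j < m) ((1 - a * p ^+ j) * (1 - p ^+ j.+1 / a)))
         @ \oo).

(* Negz m stands for - (m + 1), and the factors j = - (m + 1), ..., -1 are
   indexed by j = - (i + 1) with i < m + 1. *)
Definition qpfact (a q p : C) (k : int) : C :=
  match k with
  | Posz m => \prod_(j < m) theta (a * q ^+ j) p
  | Negz m => (\prod_(i < m.+1) theta (a * q ^- i.+1) p)^-1
  end.

Definition qpfacts (s : seq C) (q p : C) (k : int) : C :=
  \prod_(a <- s) qpfact a q p k.

Section MultiIndex.
Variable n : nat.
Implicit Types (k j N : 'I_n -> nat) (x : 'I_n -> C).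

Definition weight k : nat := (\sum_(r < n) k r)%N.

(* The parameters a, b are already substituted in B, alpha and beta. The
   summation index runs over the box of all j with j r <= N r. *)
Definition WP_Bailey_pair (B : ('I_n -> nat) -> ('I_n -> nat) -> C)
    (alpha beta : ('I_n -> nat) -> C) : Prop :=
  forall N, beta N =
    \sum_(j : {dffun forall r : 'I_n, 'I_(N r).+1})
       B N (fun r => j r : nat) * alpha (fun r => j r : nat).

Definition B5 (q p : C) x (a b : C) k j : C :=
  ((\prod_(r < n) \prod_(s < n | (r < s)%N)
      qpfact (a * x r * x s * q) q p (k r + k s)%N%:Z) *
   (\prod_(r < n)
      (qpfact (b * q ^+ (weight k - k r)%N / (a * x r)) q p
         ((k r)%:Z - (j r)%:Z) *
       qpfact (b * x r) q p (weight k + j r)%N%:Z))) /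
  (\prod_(r < n) \prod_(s < n)
     (qpfact (q ^ (1 + (j r)%:Z - (j s)%:Z) * x r / x s) q p
        ((k r)%:Z - (j r)%:Z) *
      qpfact (a * x r * x s * q) q p (k s + j r)%N%:Z)).

Definition alpha5 (q p : C) x (c d a b : C) k : C :=
  (\prod_(r < n) \prod_(s < n | (r < s)%N)
     (theta (a * x r * x s * q ^+ (k r + k s)) p / theta (a * x r * x s) p)) *
  (\prod_(r < n)
     (theta (a * x r ^+ 2 * q ^+ (2 * k r)) p / theta (a * x r ^+ 2) p)) *
  (b / a) ^+ weight k *
  q ^+ (\sum_(r < n) \sum_(s < n | (r < s)%N) k r * k s)%N *
  (\prod_(r < n) \prod_(s < n)
     (qpfact (a * x r * x s) q p (k r)%:Z /
      qpfact (q * x r / x s) q p (k r)%:Z)) *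
  (\prod_(r < n)
     (qpfacts [:: a ^+ 2 * x r * q / (b * c * d); c * x r; d * x r]
        q p (k r)%:Z /
      qpfacts [:: a * x r * q / c; a * x r * q / d; b * c * d * x r / a]
        q p (k r)%:Z)) *
  (\prod_(r < n) x r ^- k r).

Definition beta5 (q p : C) x (c d a b : C) k : C :=
  (qpfacts [:: b * c / a; b * d / a; a * q / (c * d)] q p (weight k)%:Z *
   (\prod_(r < n) qpfact (b * x r) q p (weight k)%:Z)) /
  ((\prod_(r < n) \prod_(s < n) qpfact (q * x r / x s) q p (k r)%:Z) *
   (\prod_(r < n)
      qpfacts [:: b * c * d * x r / a; a * x r * q / c; a * x r * q / d]
        q p (k r)%:Z)).

End MultiIndex.
End Elliptic.

(* Main.v *)
Require Import Defs.
From mathcomp Require Import ring lra zify.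
Import ComplexField.Normc.

Set Implicit Arguments.
Unset Strict Implicit.
Unset Printing Implicit Defensive.

Local Open Scope ring_scope.

(** Clearing denominators turns the claim into one summation formula. With
    e = a^2 q / (b c d) and B = b q^|N|, the sum of [summand] over the box of
    all j with j_r <= N_r has to equal
      box_norm N * (aq/(de), aq/(ce), aq/(cd))_|N|,
    an elliptic Jackson sum attached to the root system C_n, in which c, d, e
    play symmetric roles ([box_formula]).

    The formula is proved by interpolation. Fix b, e and c d = sigma^2, and put
    c = sigma y, d = sigma / y. Each theta factor containing c is matched by one
    containing d, so that both sides become sums of products of |N| factors
    theta(u y) theta(u / y). The addition formula for theta functions says that
    such a factor is a linear form in two functions g0(y), g1(y) that do not
    depend on u ([theta_rank2]). Hence the difference of the two sides is a form
    of degree |N| in g0(y), g1(y), and it vanishes identically as soon as it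
    vanishes at |N| + 1 points with distinct ratios g0 : g1 ([homog_zero]).

    The points are as follows. At c = 1 / (x_r q^i) with 0 <= i < N_r, all terms
    with j_r > i vanish, and what remains is a multiple of the sum over the box
    in which N_r is replaced by i ([box_sum_trunc]). At c = a q^(N_r) x_r, only
    the terms with j_r = N_r survive, and they form a multiple of the sum in
    which N_r is replaced by 0 ([box_sum_sat]). The right-hand side changes by
    the same multiples, so induction on |N| settles all these points; the first
    family has |N| members, and one point of the second kind completes it.

    The points are distinct only if c d avoids finitely many values modulo the
    zeros of theta. To reach all parameters, keep c e fixed instead and let c
    run through q^m for large m: then c d is admissible, because theta cannot
    vanish at two points u q^m ([theta_generic]), and a second interpolation
    in c finishes the proof ([box_formula_all]).

    The addition formula itself comes from series. By the Jacobi triple product,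
    theta(a) is a constant times the sum over k in Z of s^(k^2) (-a/s)^k, where
    s^2 = p. The product of this series at z y and at z / y is a double series
    over pairs (k, l); the substitutions (k, l) = (i + j, i - j) and
    (i + j + 1, i - j), one for each parity of k + l, separate z from y
    ([gauss_series_prod]). The triple product is obtained from its finite form
    [triple_finite] by dominated convergence ([tannery]). *)

(** * Limits of complex sequences *)

Section ComplexSeq.
Local Open Scope classical_set_scope.
Variable R : realType.
Local Notation C := (Num.NumField.sort (R[i] : numFieldType)).
Local Notation nm := (@normc R).
Local Notation cRe := (@complex.Re R).
Local Notation cIm := (@complex.Im R).
Implicit Types (u v : nat -> C) (z l : C).

Lemma nm_ge0 z : 0 <= nm z.
Proof. by case: z => a b; rewrite /= sqrtr_ge0. Qed.

Lemma norm_normc z : `|z| = (nm z)%:C%C.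
Proof. by case: z => a b; rewrite normc_def. Qed.

(** The norm of R[i] takes values in R[i]; the real-valued norm makes
    estimates accessible to linear arithmetic over R. *)
Lemma cvg_normcP u l :
  (u @ \oo --> l) <->
  forall e : R, 0 < e -> exists M, forall m, (M <= m)%N -> nm (l - u m) < e.
Proof.
split=> [/cvgrPdist_lt ul e e0|h].
  have e0' : 0 < e%:C%C by rewrite ltcR.
  have [M _ hM] := ul _ e0'; exists M => m Mm.
  by have := hM m Mm; rewrite /= norm_normc ltcR.
apply/cvgrPdist_lt => e; rewrite ltcE /= => /andP[/eqP e2 e1].
have [M hM] := h _ e1; exists M => // m /= Mm.
by rewrite norm_normc ltcE /= e2 eqxx hM.
Qed.

Lemma nm_le_ReIm z : nm z <= `|cRe z| + `|cIm z|.
Proof.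
case: z => a b /=; rewrite -(@ler_pXn2r _ 2) ?nnegrE ?addr_ge0 ?sqrtr_ge0 //.
rewrite sqr_sqrtr ?addr_ge0 ?sqr_ge0 // sqrrD !real_normK ?num_real //.
by rewrite -addrA [_ *+ 2 + _]addrC addrA lerDl mulrn_wge0 // mulr_ge0.
Qed.

Lemma Re_le_nm z : `|cRe z| <= nm z.
Proof.
case: z => a b /=; rewrite -(@ler_pXn2r _ 2) ?nnegrE ?sqrtr_ge0 //.
by rewrite sqr_sqrtr ?addr_ge0 ?sqr_ge0 // real_normK ?num_real // lerDl sqr_ge0.
Qed.

Lemma Im_le_nm z : `|cIm z| <= nm z.
Proof.
case: z => a b /=; rewrite -(@ler_pXn2r _ 2) ?nnegrE ?sqrtr_ge0 //.
by rewrite sqr_sqrtr ?addr_ge0 ?sqr_ge0 // real_normK ?num_real // lerDr sqr_ge0.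
Qed.

Lemma geo_cvgR (v : nat -> R) (A r : R) : 0 <= r < 1 ->
  (forall m, `|v m.+1 - v m| <= A * r ^+ m) -> exists k : R, v @ \oo --> k.
Proof.
move=> /andP[r0 r1] h.
have cg : cvgn (series (geometric A r)).
  by apply: is_cvg_geometric_series; rewrite ger0_norm.
have ct : cvgn (series (telescope v)).
  have A0 : 0 <= A by have := le_trans (normr_ge0 _) (h 0%N); rewrite expr0 mulr1.
  apply: normed_cvg; apply: series_le_cvg cg => n //=.
    by rewrite mulr_ge0 ?exprn_ge0.
  exact: h.
exists (v 0%N + limn (series (telescope v))).
have E : (fun m => v 0%N + series (telescope v) m) = v.
  by apply/funext => m; rewrite -eq_sum_telescope.
by rewrite -{1}E; apply: cvgD; [exact: cvg_cst | exact: ct].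
Qed.

(** Completeness of the complex numbers is used only through this criterion,
    which reduces to real and imaginary parts. *)
Lemma geo_cvg u (A r : R) : 0 <= r < 1 ->
  (forall m, nm (u m.+1 - u m) <= A * r ^+ m) -> exists l, u @ \oo --> l.
Proof.
move=> r01 h.
have [la hla] : exists k : R, (fun m => cRe (u m)) @ \oo --> k.
  apply: (@geo_cvgR _ A r r01) => m; apply: le_trans (h m).
  by rewrite -raddfB /=; apply: Re_le_nm.
have [lb hlb] : exists k : R, (fun m => cIm (u m)) @ \oo --> k.
  apply: (@geo_cvgR _ A r r01) => m; apply: le_trans (h m).
  by rewrite -raddfB /=; apply: Im_le_nm.
exists (la +i* lb)%C; apply/cvg_normcP => e e0.
have e20 : 0 < e / 2 by rewrite divr_gt0.
move/cvgrPdist_lt : hla => /(_ _ e20)[Ma _ hMa].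
move/cvgrPdist_lt : hlb => /(_ _ e20)[Mb _ hMb].
exists (maxn Ma Mb) => m; rewrite geq_max => /andP[m1 m2].
apply: le_lt_trans (nm_le_ReIm _) _.
rewrite [e]splitr.
have := hMa m m1; have := hMb m m2; case: (u m) => a b /= hb ha.
exact: ltrD.
Qed.
End ComplexSeq.

(** * Dominated summation over finite sets *)

Section Summation.
Local Open Scope classical_set_scope.
Variable R : realType.
Local Notation C := (Num.NumField.sort (R[i] : numFieldType)).
Local Notation nm := (@normc R).

Lemma nmD (y z : C) : nm (y + z) <= nm y + nm z.
Proof. exact: le_normcD. Qed.

Lemma nmN (z : C) : nm (- z) = nm z.
Proof. exact: normcN. Qed.

Lemma nmB (y z : C) : nm (y - z) <= nm y + nm z.
Proof. by rewrite -(nmN z) nmD. Qed.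

Lemma nmX (z : C) n : nm (z ^+ n) = nm z ^+ n.
Proof. by elim: n => [|n IH]; rewrite ?expr0 ?normc1 // !exprS normcM IH. Qed.

Lemma nm_eq0 (z : C) : (nm z == 0) = (z == 0).
Proof. by apply/eqP/eqP => [/eq0_normc|->] //; exact: normc0. Qed.

Lemma nm_gt0 (z : C) : (0 < nm z) = (z != 0).
Proof. by rewrite lt_def nm_ge0 andbT nm_eq0. Qed.

Lemma nm_sum (I : Type) (s : seq I) (f : I -> C) :
  nm (\sum_(i <- s) f i) <= \sum_(i <- s) nm (f i).
Proof.
elim: s => [|i s IH]; first by rewrite !big_nil normc0.
by rewrite !big_cons (le_trans (nmD _ _)) // lerD2l.
Qed.

Lemma eventually_seq (I : eqType) (s : seq I) (P : I -> nat -> Prop) :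
  (forall i, exists M, forall m, (M <= m)%N -> P i m) ->
  exists M, forall m, (M <= m)%N -> forall i, i \in s -> P i m.
Proof.
move=> h; elim: s => [|i s [M1 h1]]; first by exists 0%N.
have [M2 h2] := h i; exists (maxn M1 M2) => m; rewrite geq_max => /andP[m1 m2] k.
by rewrite inE => /orP[/eqP->|]; [exact: h2 | exact: h1].
Qed.

Section Dominated.
Variable I : eqType.
Implicit Types (s t : seq I) (w : I -> R) (f : I -> C).

Lemma sum_uniq_sub (V : nmodType) (g : I -> V) s t :
  uniq s -> uniq t -> {subset s <= t} ->
  \sum_(i <- t) g i = \sum_(i <- s) g i + \sum_(i <- t | i \notin s) g i.
Proof.
move=> us ut st; rewrite [LHS](bigID (mem s)) /=; congr (_ + _).
rewrite -big_filter; apply: perm_big; apply: uniq_perm; rewrite ?filter_uniq //.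
move=> i; rewrite mem_filter /=; case: (boolP (i \in s)) => //= /st ->; by [].
Qed.

(** Summability of a nonnegative family over an unordered index type;
    duplicate-free lists stand for finite sets. *)
Definition sum_bounded w (B : R) := forall s, uniq s -> \sum_(i <- s) w i <= B.

(** A finite sum close to the supremum of all finite sums leaves little room
    outside its index set. *)
Lemma small_tail w B : (forall i, 0 <= w i) -> sum_bounded w B ->
  forall e : R, 0 < e -> exists2 s0, uniq s0 &
    forall s, uniq s -> \sum_(i <- s | i \notin s0) w i <= e.
Proof.
move=> w0 wB e e0.
pose E := [set y | exists2 s, uniq s & y = \sum_(i <- s) w i].
have supE : has_sup E.
  split; first by exists 0, [::] => //; rewrite big_nil.
  by exists B => _ [s us ->]; exact: wB.
have [_ [s0 us0 ->] lt0] := sup_adherent e0 supE.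
exists s0 => // s us; rewrite -big_filter.
set t := [seq i <- s | i \notin s0].
have ust : uniq (s0 ++ t).
  rewrite cat_uniq us0 filter_uniq // andbT; apply/hasPn => i.
  by rewrite mem_filter => /andP[].
have Est : E (\sum_(i <- s0 ++ t) w i) by exists (s0 ++ t).
have := sup_upper_bound supE Est.
rewrite big_cat /=; move: lt0; set y := \sum_(i <- s0) _; set z := \sum_(i <- t) _.
lra.
Qed.

(** Dominated convergence along two exhaustions of the index set. For constant
    coefficients it says that a summable family has the same sum along every
    exhaustion, which is what allows a double series to be rearranged. *)
Lemma tannery f w B (K : R) (As Bs : nat -> seq I) (c : nat -> I -> C) (kap : C) :
  (forall i, nm (f i) <= w i) -> sum_bounded w B ->
  (forall m, uniq (As m)) -> (forall m, uniq (Bs m)) ->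
  (forall i, exists M, forall m, (M <= m)%N -> i \in As m) ->
  (forall i, exists M, forall m, (M <= m)%N -> i \in Bs m) ->
  (forall m i, nm (c m i) <= K) -> (forall i, (fun m => c m i) @ \oo --> kap) ->
  (fun m => \sum_(i <- As m) c m i * f i - kap * \sum_(i <- Bs m) f i) @ \oo --> (0 : C).
Proof.
move=> fw wB uA uB inA inB cK ck; apply/cvg_normcP => e e0.
have w0 i : 0 <= w i by apply: le_trans (fw i); exact: nm_ge0.
have B0 : 0 <= B by have := wB [::] isT; rewrite big_nil.
have k0 := nm_ge0 kap.
have [[i0 _]|noI] := pselect (exists i : I, True); last first.
  have nil s : s = [::] by case: s => // i s; case: noI; exists i.
  exists 0%N => m _; rewrite (nil (As m)) (nil (Bs m)) !big_nil mulr0 subr0 subr0 normc0 //.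
have K0 : 0 <= K.
  by apply: le_trans (cK 0%N i0); exact: nm_ge0.
(* The tails on both sides together weigh at most K + |kap|; the 1 keeps Z positive. *)
pose Z := K + nm kap + 1.
have Z0 : 0 < Z by rewrite /Z; lra.
have [s0 us0 tail] := small_tail w0 wB (e := e / (2 * Z)) ltac:(by rewrite divr_gt0 // mulr_gt0).
pose del := e / (2 * (B + 1)).
have del0 : 0 < del by rewrite divr_gt0 // mulr_gt0 //; lra.
have [M1 h1] := eventually_seq s0 inA.
have [M2 h2] := eventually_seq s0 inB.
have [M3 h3] : exists M, forall m, (M <= m)%N -> forall i, i \in s0 -> nm (c m i - kap) < del.
  apply: eventually_seq => i; have /cvg_normcP/(_ _ del0)[M hM] := ck i.
  by exists M => m /hM; rewrite -nmN opprB.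
exists (maxn M1 (maxn M2 M3)) => m; rewrite !geq_max => /and3P[m1 m2 m3].
rewrite sub0r nmN.
rewrite (sum_uniq_sub _ us0 (uA m) (h1 m m1)) (sum_uniq_sub _ us0 (uB m) (h2 m m2)).
set TA := \sum_(i <- As m | _) _; set TB := \sum_(i <- Bs m | _) _.
have -> : \sum_(i <- s0) c m i * f i + TA - kap * (\sum_(i <- s0) f i + TB) =
    \sum_(i <- s0) (c m i - kap) * f i + TA - kap * TB.
  have -> : \sum_(i <- s0) (c m i - kap) * f i = \sum_(i <- s0) c m i * f i - kap * \sum_(i <- s0) f i.
    by rewrite mulr_sumr -sumrB; apply: eq_bigr => i _; rewrite mulrBl.
  by ring.
have b1 : nm (\sum_(i <- s0) (c m i - kap) * f i) <= del * B.
  apply: le_trans (nm_sum _ _) _.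
  apply: (@le_trans _ _ (\sum_(i <- s0) del * w i)).
    rewrite big_seq [leRHS]big_seq; apply: ler_sum => i is0; rewrite normcM.
    by apply: ler_pM; rewrite ?nm_ge0 // ltW // h3.
  by rewrite -mulr_sumr; apply: ler_wpM2l; [exact: ltW | exact: wB].
have b2 : nm TA <= K * (e / (2 * Z)).
  rewrite /TA -big_filter; apply: le_trans (nm_sum _ _) _.
  apply: (@le_trans _ _ (\sum_(i <- As m | i \notin s0) K * w i)).
    by rewrite big_filter; apply: ler_sum => i _; rewrite normcM ler_pM ?nm_ge0.
  by rewrite -mulr_sumr ler_wpM2l // tail.
have b3 : nm (kap * TB) <= nm kap * (e / (2 * Z)).
  rewrite normcM ler_wpM2l // /TB -big_filter; apply: le_trans (nm_sum _ _) _.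
  rewrite big_filter; apply: le_trans (tail _ (uB m)).
  by rewrite ler_sum.
have b4 : K * (e / (2 * Z)) + nm kap * (e / (2 * Z)) < e / 2.
  have -> : e / 2 = Z * (e / (2 * Z)) by field; rewrite gt_eqF.
  rewrite -mulrDl ltr_pM2r; first by rewrite /Z; lra.
  by rewrite divr_gt0 // mulr_gt0.
have b5 : del * B < e / 2.
  have -> : e / 2 = del * (B + 1) by rewrite /del; field; rewrite gt_eqF //; lra.
  by rewrite ltr_pM2l //; lra.
have := nmB (\sum_(i <- s0) (c m i - kap) * f i + TA) (kap * TB).
have := nmD (\sum_(i <- s0) (c m i - kap) * f i) TA.
lra.
Qed.
End Dominated.

Lemma sum_bounded_prod (I J : eqType) (w : I -> R) (v : J -> R) B D :
  (forall i, 0 <= w i) -> (forall j, 0 <= v j) -> sum_bounded w B -> sum_bounded v D ->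
  sum_bounded (fun p : I * J => w p.1 * v p.2) (B * D).
Proof.
move=> w0 v0 wB vD s us.
pose s1 := undup (unzip1 s); pose s2 := undup (unzip2 s).
pose t := [seq (i, j) | i <- s1, j <- s2].
have ut : uniq t by apply: allpairs_uniq; rewrite ?undup_uniq // => -[] ? ? [].
have st : {subset s <= t}.
  move=> [i j] ij; apply/allpairsP; exists (i, j); split=> //; rewrite mem_undup.
    exact: (map_f fst ij).
  exact: (map_f snd ij).
apply: (@le_trans _ _ (\sum_(p <- t) w p.1 * v p.2)).
  by rewrite (sum_uniq_sub _ us ut st) lerDl sumr_ge0 // => p _; rewrite mulr_ge0.
rewrite /t big_allpairs /=.
under eq_bigr do rewrite -mulr_sumr.
rewrite -mulr_suml; apply: ler_pM; rewrite ?sumr_ge0 //.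
  by apply: wB; rewrite undup_uniq.
by apply: vD; rewrite undup_uniq.
Qed.

Lemma sum_bounded_nat (r : R) : 0 <= r < 1 -> sum_bounded (fun n : nat => r ^+ n) (1 - r)^-1.
Proof.
move=> /andP[r0 r1] s us.
have r1' : 0 < 1 - r by rewrite subr_gt0.
pose L := (\max_(n <- s) n).+1.
have st : {subset s <= iota 0 L}.
  by move=> n ns; rewrite mem_iota /= add0n ltnS; apply: leq_bigmax_seq.
apply: (@le_trans _ _ (\sum_(n <- iota 0 L) r ^+ n)).
  by rewrite (sum_uniq_sub _ us (iota_uniq _ _) st) lerDl sumr_ge0 // => p _; rewrite exprn_ge0.
rewrite -[iota 0 L]/(index_iota 0 L) -(ler_pM2l r1') mulfV ?gt_eqF //.
have := subrX1 r L; rewrite big_mkord => E.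
have -> : (1 - r) * \sum_(i < L) r ^+ i = 1 - r ^+ L.
  by rewrite -[1 - r]opprB mulNr -E opprB.
by rewrite lerBlDr lerDl exprn_ge0.
Qed.

Lemma sum_bounded_int (r : R) : 0 <= r < 1 -> sum_bounded (fun k : int => r ^+ `|k|%N) ((1 - r)^-1 + (1 - r)^-1).
Proof.
move=> r01 s us; rewrite (bigID (fun k : int => (0 <= k)%R)) /=.
have part (P : pred int) : {in P &, injective absz} ->
    \sum_(k <- s | P k) r ^+ `|k|%N <= (1 - r)^-1.
  move=> inj; rewrite -big_filter.
  rewrite -(big_map absz xpredT (fun n => r ^+ n)).
  apply: sum_bounded_nat => //; rewrite map_inj_in_uniq ?filter_uniq //.
  by move=> k l; rewrite !mem_filter => /andP[Pk _] /andP[Pl _]; apply: inj.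
apply: lerD; apply: part => -[k|k] [l|l] // _ _ /=; first by move=> ->.
by move=> [->].
Qed.
End Summation.

Section NumFieldSeq.
Local Open Scope classical_set_scope.
Variable K : numFieldType.
Implicit Types (u v : nat -> K) (k l : K).

Lemma seq_cvgM u v k l : u @ \oo --> k -> v @ \oo --> l ->
  (fun m => u m * v m) @ \oo --> k * l.
Proof. by move=> uk vl; exact: cvgM. Qed.

Lemma seq_cvgD u v k l : u @ \oo --> k -> v @ \oo --> l ->
  (fun m => u m + v m) @ \oo --> k + l.
Proof. by move=> uk vl; exact: cvgD. Qed.

Lemma seq_cvg_unique u k l : u @ \oo --> k -> u @ \oo --> l -> k = l.
Proof. by move=> uk ul; apply: (cvg_unique _ uk ul). Qed.

Lemma seq_cvg_cst u k : (forall m, u m = k) -> u @ \oo --> k.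
Proof. by move=> /funext ->; exact: cvg_cst. Qed.

Lemma seq_cvgV u k : k != 0 -> u @ \oo --> k -> (fun m => (u m)^-1) @ \oo --> k^-1.
Proof. by move=> k0 uk; exact: cvgV. Qed.

Lemma seq_cvg_ext u v k : (forall m, v m = u m) -> u @ \oo --> k -> v @ \oo --> k.
Proof. by move=> /funext ->. Qed.

Lemma seq_lim u k : u @ \oo --> k -> lim (u @ \oo) = k.
Proof. by move=> uk; apply: cvg_lim uk; exact: norm_hausdorff. Qed.
End NumFieldSeq.

(** * Infinite products *)

Section Products.
Local Open Scope classical_set_scope.
Variable R : realType.
Local Notation C := (Num.NumField.sort (R[i] : numFieldType)).
Local Notation nm := (@normc R).

Lemma cvg_bounded (u : nat -> C) (l : C) : u @ \oo --> l -> exists K, forall m, nm (u m) <= K.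
Proof.
move=> /cvg_normcP/(_ 1 ltr01)[M hM].
have S0 : 0 <= \sum_(j < M) nm (u j) by rewrite sumr_ge0 // => j _; exact: nm_ge0.
exists (1 + nm l + \sum_(j < M) nm (u j)) => m.
have [mM|Mm] := ltnP m M.
  rewrite (bigD1 (Ordinal mM)) //= addrCA lerDl.
  have : 0 <= \sum_(i < M | i != Ordinal mM) nm (u i) by rewrite sumr_ge0 // => j _; exact: nm_ge0.
  by have := nm_ge0 l; lra.
have := hM m Mm; have := nmB l (l - u m); rewrite opprB addrC subrK.
by lra.
Qed.

Lemma geo_eventually (A r e : R) : 0 <= r < 1 -> 0 < e -> exists J, forall m, (J <= m)%N -> A * r ^+ m < e.
Proof.
move=> /andP[r0 r1] e0.
have /cvgrPdist_lt/(_ _ e0)[J _ hJ] : geometric A r @ \oo --> 0.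
  by apply: cvg_geometric; rewrite ger0_norm.
exists J => m Jm; have := hJ m Jm; rewrite /= sub0r normrN.
by apply: le_lt_trans; exact: ler_norm.
Qed.

(** The partial products are bounded by an exponential of a geometric sum, so
    their increments decay geometrically. *)
Lemma prod_cvg (z : nat -> C) (A r : R) : 0 <= r < 1 -> (forall j, nm (z j) <= A * r ^+ j) ->
  exists l : C, (fun m => \prod_(j < m) (1 + z j)) @ \oo --> l.
Proof.
move=> r01 zA; have /andP[r0 r1] := r01.
have A0 : 0 <= A by have := zA 0%N; rewrite expr0 mulr1; apply: le_trans; exact: nm_ge0.
pose K := expR (A * (1 - r)^-1).
have bd m : nm (\prod_(j < m) (1 + z j)) <= K.
  apply: (@le_trans _ _ (expR (\sum_(j < m) A * r ^+ j))).
    rewrite expR_sum; elim: m => [|m IH]; first by rewrite !big_ord0 normc1.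
    rewrite !big_ord_recr /= normcM; apply: ler_pM; rewrite ?nm_ge0 //.
    apply: le_trans (nmD _ _) _; rewrite normc1.
    by apply: le_trans (expR_ge1Dx _); rewrite lerD2l.
  rewrite ler_expR -mulr_sumr ler_wpM2l //.
  have := sum_bounded_nat r01 (iota_uniq 0 m).
  by rewrite -{1}(subn0 m) -[iota 0 (m - 0)]/(index_iota 0 m) big_mkord.
apply: (geo_cvg (A := K * A) r01) => m.
have -> : \prod_(j < m.+1) (1 + z j) - \prod_(j < m) (1 + z j) = \prod_(j < m) (1 + z j) * z m.
  by rewrite big_ord_recr /=; ring.
by rewrite normcM -mulrA; apply: ler_pM; rewrite ?nm_ge0.
Qed.

(** From some index J on, the inverse factors are again small perturbations of
    1, so their products converge too; the product of the two limits is the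
    nonzero partial product up to J. *)
Lemma prod_lim_neq0 (z : nat -> C) (A r : R) (l : C) :
  0 <= r < 1 -> (forall j, nm (z j) <= A * r ^+ j) -> (forall j, 1 + z j != 0) ->
  (fun m => \prod_(j < m) (1 + z j)) @ \oo --> l -> l != 0.
Proof.
move=> r01 zA z0 ul; have /andP[r0 r1] := r01.
have half0 : 0 < (1 / 2 : R) by lra.
have [J hJ] := geo_eventually A r01 half0.
pose z' j : C := (1 + z (J + j)%N)^-1 - 1.
have z'b j : nm (z' j) <= (2 * A * r ^+ J) * r ^+ j.
  have -> : z' j = - z (J + j)%N / (1 + z (J + j)%N).
    by rewrite /z'; field; rewrite z0.
  have zs := zA (J + j)%N; have zl := hJ (J + j)%N (leq_addr _ _).
  have lb : 1 / 2 <= nm (1 + z (J + j)%N).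
    have := nmB (1 + z (J + j)%N) (z (J + j)%N); rewrite addrK normc1; lra.
  rewrite normcM normcV nmN -mulrA -exprD ler_pdivrMr; last by apply: lt_le_trans lb.
  apply: le_trans zs _; have := nm_ge0 (z (J + j)%N).
  have y0 : 0 <= A * r ^+ (J + j) by apply: le_trans (zA (J + j)%N); exact: nm_ge0.
  move=> _; rewrite -mulrA mulrAC -[leLHS]mul1r ler_wpM2r // -ler_pdivrMl //; lra.
have [lv hv] := prod_cvg r01 z'b.
pose u m : C := \prod_(j < m) (1 + z j).
have uJ m : u (J + m)%N * \prod_(j < m) (1 + z' j) = u J.
  rewrite /u big_split_ord /= -mulrA -big_split /= -[RHS]mulr1; congr (_ * _); apply: big1 => j _.
  by rewrite /z' [1 + (_ - 1)]addrC subrK mulfV.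
have ulJ : (fun m => u (J + m)%N) @ \oo --> l.
  apply/cvg_normcP => e e0; have /cvg_normcP/(_ _ e0)[M hM] := ul.
  by exists M => m Mm; apply: hM; rewrite (leq_trans Mm) ?leq_addl.
have uJl := seq_cvgM ulJ hv.
have E : l * lv = u J by apply: (seq_cvg_unique uJl); apply: seq_cvg_cst uJ.
apply/negP => /eqP l0; have : u J != 0 by apply/prodf_neq0 => j _.
by rewrite -E l0 mul0r eqxx.
Unshelve. all: by end_near.
Qed.
End Products.

(** * The finite Jacobi triple product *)

(** The integers from -m to m, listed so that passing to m + 1 adds the two
    new ends in front. *)
Fixpoint window (m : nat) : seq int :=
  if m is m'.+1 then (- m%:Z) :: m%:Z :: window m' else [:: 0].

Lemma mem_window m k : (k \in window m) = (`|k| <= m)%N.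
Proof.
elim: m => [|m IH]; first by rewrite inE leqn0 absz_eq0.
rewrite !inE IH; lia.
Qed.

Lemma window_uniq m : uniq (window m).
Proof.
elim: m => [//|m IH] /=; rewrite inE !mem_window IH; lia.
Qed.

Lemma mem_window_eventually k : exists M, forall m, (M <= m)%N -> k \in window m.
Proof. by exists `|k|%N => m; rewrite mem_window. Qed.

Lemma sum_window_support (V : nmodType) (g : int -> V) m (s : seq int) :
  uniq s -> (forall k, g k != 0 -> (`|k| <= m)%N) -> {subset window m <= s} ->
  \sum_(k <- s) g k = \sum_(k <- window m) g k.
Proof.
move=> us g0 sub; rewrite (sum_uniq_sub _ (window_uniq m) us sub).
rewrite [X in _ + X]big1 ?addr0 // => k; rewrite mem_window => km.
by apply/eqP; apply: contraR km; apply: g0.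
Qed.

(** Shifting the summation index by at most one costs one extra step of the
    window; this absorbs the factors a and 1/a in the induction for the triple
    product. *)
Lemma sum_window_shift (V : nmodType) (g : int -> V) m (d : int) :
  (`|d| <= 1)%N -> (forall k, g k != 0 -> (`|k| <= m)%N) ->
  \sum_(k <- window m.+1) g (k + d) = \sum_(k <- window m) g k.
Proof.
move=> d1 g0; rewrite -(big_map (fun k => k + d) xpredT g).
apply: sum_window_support => //.
  by rewrite map_inj_uniq ?window_uniq //; exact: addIr.
move=> k; rewrite mem_window => km; apply/mapP; exists (k - d); last by rewrite subrK.
rewrite mem_window; lia.
Qed.

Section TripleProduct.
Variables (C : fieldType) (p : C).
Hypothesis p0 : p != 0.

Definition euler_prod (m : nat) : C := \prod_(j < m) (1 - p ^+ j.+1).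
(** The inverse 1/(p;p)_j, set to zero for negative j. With this convention
    the recursion [inv_euler_prod_pred] holds for every integer, so that the
    ends of the window need no separate treatment. *)
Definition inv_euler_prod (j : int) : C := if j is Posz m then (euler_prod m)^-1 else 0.
(** The Gaussian binomial coefficient of 2m over m + k in base p. *)
Definition triple_coeff (m : nat) (k : int) : C := euler_prod (2 * m) * inv_euler_prod (m%:Z + k) * inv_euler_prod (m%:Z - k).
(** For s^2 = p, the term s^(k^2) (-a/s)^k equals (-1)^k p^(k(k-1)/2) a^k.
    Completing the square in this way makes the change of summation indices k
    = i + j, l = i - j symmetric. *)
Definition gauss_term (s z : C) (k : int) : C := s ^ (k * k) * z ^ k.
Definition theta_partial (a : C) (m : nat) : C := \prod_(j < m) ((1 - a * p ^+ j) * (1 - p ^+ j.+1 / a)).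

Hypothesis one_sub_exp_neq0 : forall j, 1 - p ^+ j.+1 != 0.

Lemma inv_euler_prod_pred j : inv_euler_prod (j - 1) = (1 - p ^ j) * inv_euler_prod j.
Proof.
case: j => [[|m]|m].
- by rewrite expr0z subrr mul0r.
- have -> : m.+1%:Z - 1 = m%:Z by lia.
  rewrite /inv_euler_prod -exprnP; have -> : euler_prod m.+1 = euler_prod m * (1 - p ^+ m.+1) by rewrite /euler_prod big_ord_recr.
  by rewrite invfM mulrCA mulfV ?mulr1 ?one_sub_exp_neq0.
- have -> : Negz m - 1 = Negz m.+1 by lia.
  by rewrite /= mulr0.
Qed.

(** A three-term recursion replacing the two Pascal rules. In terms of U =
    p^(m+1+k) and V = p^(m+1-k) it is a polynomial identity. *)
Lemma triple_coeff_step m k :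
  triple_coeff m.+1 k = (1 + p ^+ (2 * m).+1) * triple_coeff m k + p ^ (m%:Z + 1 - k) * triple_coeff m (k - 1)
     + p ^ (m%:Z + 1 + k) * triple_coeff m (k + 1).
Proof.
rewrite /triple_coeff; set u := m%:Z + 1 + k; set v := m%:Z + 1 - k.
have -> : m.+1%:Z + k = u by rewrite /u; lia.
have -> : m.+1%:Z - k = v by rewrite /v; lia.
have -> : m%:Z + k = u - 1 by rewrite /u; lia.
have -> : m%:Z - k = v - 1 by rewrite /v; lia.
have -> : m%:Z + (k - 1) = u - 1 - 1 by rewrite /u; lia.
have -> : m%:Z - (k - 1) = v by rewrite /v; lia.
have -> : m%:Z + (k + 1) = u by rewrite /u; lia.
have -> : m%:Z - (k + 1) = v - 1 - 1 by rewrite /v; lia.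
rewrite !inv_euler_prod_pred.
have -> : euler_prod (2 * m.+1) = euler_prod (2 * m) * (1 - p ^+ (2 * m).+1) * (1 - p ^+ (2 * m).+2).
  by rewrite mulnS /euler_prod !big_ord_recr /=.
have e1 : p ^+ (2 * m).+2 = p ^ u * p ^ v.
  by rewrite -expfzDr // exprnP; congr (_ ^ _); rewrite /u /v; lia.
have e2 : p ^+ (2 * m).+1 = p ^ u * p ^ v / p.
  by rewrite -e1 [in RHS]exprS [p * _]mulrC mulfK.
rewrite e2 e1.
have e3 w : p ^ (w - 1) = p ^ w / p by rewrite expfzDr.
rewrite !e3; move: (p ^ u) (p ^ v) => U V.
by field.
Qed.

Lemma triple_coeff_support m k : triple_coeff m k != 0 -> (`|k| <= m)%N.
Proof.
apply: contraR; rewrite -ltnNge => mk; apply/eqP; rewrite /triple_coeff.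
have [k0|k0] := leP 0 k.
  have -> : m%:Z - k = Negz (`|k| - m).-1 by lia.
  by rewrite mulr0.
have -> : m%:Z + k = Negz (`|k| - m).-1 by lia.
by rewrite mulr0 mul0r.
Qed.

(** Multiplication by the next two factors of the theta product adds to each
    term its two neighbours, shifted by a and 1/a; the recursion for the
    coefficients is exactly this operation. *)
Lemma triple_finite (s a : C) m : s ^+ 2 = p -> a != 0 ->
  theta_partial a m = \sum_(k <- window m) triple_coeff m k * gauss_term s (- a / s) k.
Proof.
move=> sE a0; have s0 : s != 0 by apply: contraNneq p0 => s0; rewrite -sE s0 expr0n.
have z0 : - a / s != 0 by rewrite mulf_neq0 ?invr_neq0 // oppr_eq0.
elim: m => [|m IH].
  rewrite /theta_partial big_ord0 /= big_seq1 /triple_coeff /gauss_term /= /euler_prod !big_ord0 !expr0z invr1 !mulr1 //.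
pose T k := triple_coeff m k * gauss_term s (- a / s) k.
have T0 k : T k != 0 -> (`|k| <= m)%N.
  by move=> Tk; apply: triple_coeff_support; apply: contraNneq Tk => ck; rewrite /T ck mul0r.
rewrite {1}/theta_partial big_ord_recr /= -/(theta_partial a m) IH -/(T _).
have S0 := sum_window_shift (g := T) (d := 0) isT T0.
have S1 := sum_window_shift (g := T) (d := 1) isT T0.
have S2 := sum_window_shift (g := T) (d := -1) isT T0.
have -> : (\sum_(k <- window m) triple_coeff m k * gauss_term s (- a / s) k) * ((1 - a * p ^+ m) * (1 - p ^+ m.+1 / a)) =
   (1 + p ^+ (2 * m).+1) * (\sum_(k <- window m) T k) - a * p ^+ m * (\sum_(k <- window m) T k)
    - p ^+ m.+1 / a * (\sum_(k <- window m) T k).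
  rewrite /T; set S := \sum_(k <- _) _.
  have -> : p ^+ (2 * m).+1 = p ^+ m * p ^+ m.+1 by rewrite -exprD; congr (_ ^+ _); lia.
  by field.
rewrite -{1}S0 -{1}S2 -S1 !mulr_sumr -!sumrB; apply: eq_bigr => k _.
rewrite triple_coeff_step /T addr0.
set g := gauss_term s _ k.
have gE d : gauss_term s (- a / s) (k + d) = s ^ (k * d + k * d + d * d) * (- a / s) ^ d * g.
  rewrite /g /gauss_term; have -> : (k + d) * (k + d) = k * k + (k * d + k * d + d * d) by ring.
  by rewrite !(expfzDr _ _ s0) (expfzDr _ _ z0); ring.
have pE d : p ^ d = s ^ (d + d) by rewrite -sE expr2 expfzMl -expfzDr.
rewrite !gE.
have -> : p ^+ m.+1 = p ^+ m * p by rewrite exprSr.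
rewrite [m%:Z + 1 - k]addrAC -[m%:Z + 1 + k]addrA !(expfzDr _ _ p0) -exprnP.
have -> : k * -1 + k * -1 + -1 * -1 = - k + - k + 1 :> int by ring.
have -> : k * 1 + k * 1 + 1 * 1 = k + k + 1 :> int by ring.
rewrite !(expfzDr _ _ s0) !expr1z exprN1 !pE !(expfzDr _ _ s0) -!invr_expz.
have S0' : s ^ k != 0 by rewrite expfz_neq0.
move: (p ^+ m) (p ^+ (2 * m).+1) (triple_coeff m k) (triple_coeff m (k - 1)) (triple_coeff m (k + 1)) => P Q c1 c2 c3; rewrite -!sE.
by field; rewrite ?oppr_eq0 ?oner_eq0 ?s0 ?a0 ?S0'.
Qed.
End TripleProduct.

(** * Gaussian series and the theta function *)

Section Theta.
Local Open Scope classical_set_scope.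
Variable R : realType.
Local Notation C := (Num.NumField.sort (R[i] : numFieldType)).
Local Notation nm := (@normc R).

Lemma seq_cvg_comp (u : nat -> C) (l : C) (h : nat -> nat) : u @ \oo --> l ->
  (forall M, exists M', forall m, (M' <= m)%N -> (M <= h m)%N) ->
  (fun m => u (h m)) @ \oo --> l.
Proof.
move=> /cvg_normcP ul hh; apply/cvg_normcP => e /ul[M hM]; have [M' hM'] := hh M.
by exists M' => m /hM'/hM.
Qed.

Definition gauss_sum (s z : C) (m : nat) : C := \sum_(k <- window m) gauss_term s z k.
Definition gauss_series (s z : C) : C := lim (gauss_sum s z @ \oo).

Lemma nm_exprz (z : C) (k : int) : nm (z ^ k) = nm z ^ k.
Proof. by case: k => n; rewrite ?NegzE -?exprnP -?invr_expz -?exprnP ?normcV nmX. Qed.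

(** Since |s|^(k^2 - |k|) |z|^k is bounded, a Gaussian term is dominated by a
    geometric one. *)
Lemma gauss_term_bound (s z : C) : s != 0 -> nm s < 1 -> z != 0 ->
  exists2 A, 0 <= A & forall k, nm (gauss_term s z k) <= A * nm s ^+ `|k|%N.
Proof.
move=> s0 s1 z0; set r := nm s; have r0 : 0 < r by rewrite nm_gt0.
(* Z dominates |z|^(+-1) and is at least 1, so |z|^k <= Z^|k|. *)
pose Z := 1 + nm z + (nm z)^-1.
have nz : 0 < nm z by rewrite nm_gt0.
have nzi : 0 < (nm z)^-1 by rewrite invr_gt0.
have Z1 : 1 <= Z by rewrite /Z; lra.
have Z0 : 0 <= Z by lra.
have zk k : nm z ^ k <= Z ^+ `|k|%N.
  case: k => n; rewrite ?NegzE -?invr_expz -exprnP ?abszN absz_nat -?exprVn.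
    by apply: lerXn2r; rewrite ?nnegrE ?Z0 //; rewrite /Z; lra.
  by apply: lerXn2r; rewrite ?nnegrE ?Z0 //; rewrite /Z; lra.
have r01 : 0 <= r < 1 by rewrite ltW.
have [L hL] := geo_eventually Z r01 ltr01.
exists (Z ^+ L.+1) => [|k]; first by rewrite exprn_ge0.
rewrite normcM !nm_exprz -/r.
have -> : r ^ (k * k) = r ^+ (`|k| * `|k|)%N.
  by rewrite exprnP; congr (_ ^ _); lia.
apply: (@le_trans _ _ (r ^+ (`|k| * `|k|) * Z ^+ `|k|)).
  by apply: ler_wpM2l => //; rewrite exprn_ge0 // ltW.
case: `|k|%N => [|n].
  by rewrite mul0n !expr0 !mul1r mulr1 exprn_ege1.
rewrite mulnS exprD -mulrA mulrC; apply: ler_wpM2r; first by rewrite exprn_ge0 // ltW.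
rewrite mulnC exprM -exprMn.
have [nL|Ln] := ltnP n L.
  apply: (@le_trans _ _ (Z ^+ n.+1)); last by rewrite ler_weXn2l // ltnW // ltnS.
  apply: lerXn2r; rewrite ?nnegrE ?mulr_ge0 ?exprn_ge0 ?(ltW r0) //.
  by rewrite ler_piMl // exprn_ile1 // ltW.
apply: (@le_trans _ _ 1); last by rewrite exprn_ege1.
by rewrite exprn_ile1 ?mulr_ge0 ?exprn_ge0 ?(ltW r0) // mulrC ltW // hL.
Qed.

Lemma gauss_sum_cvg (s z : C) : s != 0 -> nm s < 1 -> z != 0 -> gauss_sum s z @ \oo --> gauss_series s z.
Proof.
move=> s0 s1 z0; have r0 : 0 < nm s by rewrite nm_gt0.
have r01 : 0 <= nm s < 1 by rewrite ltW.
have [A A0 hA] := gauss_term_bound s0 s1 z0.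
have [l hl] : exists l : C, gauss_sum s z @ \oo --> l.
  apply: (geo_cvg (A := A * nm s + A * nm s) r01) => m.
  have -> : gauss_sum s z m.+1 - gauss_sum s z m = gauss_term s z (- m.+1%:Z) + gauss_term s z m.+1%:Z.
    by rewrite /gauss_sum /= !big_cons addrA addrK.
  apply: le_trans (nmD _ _) _; rewrite mulrDl -!mulrA -exprS.
  by apply: lerD; [have := hA (- m.+1%:Z) | have := hA m.+1%:Z]; rewrite ?abszN absz_nat.
by rewrite /gauss_series (seq_lim hl).
Qed.

Variables (p : C).
Hypothesis p1 : nm p < 1.

Lemma nmp_pow j : nm (p ^+ j.+1) < 1.
Proof. by rewrite nmX exprn_ilt1 ?nm_ge0. Qed.

Lemma one_sub_neq0 (z : C) : nm z < 1 -> 1 - z != 0.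
Proof.
move=> z1; apply/eqP => /eqP; rewrite subr_eq0 => /eqP E.
by move: z1; rewrite -E normc1 ltxx.
Qed.

Lemma one_sub_exp_neq0 j : 1 - p ^+ j.+1 != 0.
Proof. by apply: one_sub_neq0; exact: nmp_pow. Qed.

Lemma r01 : 0 <= nm p < 1. Proof. by rewrite nm_ge0. Qed.

Lemma euler_prod_cvg : exists2 l, l != 0 & euler_prod p @ \oo --> l.
Proof.
pose z j := - p ^+ j.+1 : C.
have zb j : nm (z j) <= 1 * nm p ^+ j.
  by rewrite mul1r nmN nmX exprS ler_piMl ?exprn_ge0 ?nm_ge0 // ltW.
have [l hl] := prod_cvg r01 zb.
have l0 := prod_lim_neq0 r01 zb (fun j => one_sub_exp_neq0 j) hl.
by exists l.
Qed.

(** For fixed k the coefficient tends to 1/(p;p)_oo, and it is bounded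
    uniformly in m and k: the hypotheses of dominated convergence. *)
Lemma triple_coeff_lim : exists2 kap, kap != 0 &
  (exists K, forall m k, nm (triple_coeff p m k) <= K) /\
  (forall k, (fun m => triple_coeff p m k) @ \oo --> kap).
Proof.
have [l l0 hl] := euler_prod_cvg.
have hV := seq_cvgV l0 hl.
have [K1 hK1] := cvg_bounded hl; have [K2 hK2] := cvg_bounded hV.
have K10 : 0 <= K1 by apply: le_trans (hK1 0%N); exact: nm_ge0.
have K20 : 0 <= K2 by apply: le_trans (hK2 0%N); exact: nm_ge0.
have ib j : nm (inv_euler_prod p j) <= K2.
  case: j => m; first exact: hK2.
  by have -> : nm (inv_euler_prod p (Negz m)) = 0 by exact: normc0.
have il k : (fun m : nat => inv_euler_prod p (m%:Z + k)) @ \oo --> l^-1.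
  apply/cvg_normcP => e e0; move/cvg_normcP: hV => /(_ e e0)[M hM]; exists (M + `|k|)%N => m Mm.
  have -> : m%:Z + k = (`|(m%:Z + k)%R|%N)%:Z by lia.
  by apply: hM; lia.
exists (l * l^-1 * l^-1); first by rewrite !mulf_neq0 ?invr_neq0.
split.
  exists (K1 * K2 * K2) => m k; rewrite /triple_coeff !normcM.
  by rewrite !ler_pM ?mulr_ge0 ?nm_ge0.
move=> k; apply: seq_cvgM (il (- k)); apply: seq_cvgM (il k).
apply: (seq_cvg_comp hl) => M; exists M => m Mm.
by rewrite (leq_trans Mm) // leq_pmull.
Qed.

Lemma theta_partial_cvg a : a != 0 -> exists2 l, theta_partial p a @ \oo --> l &
  ((forall j, (1 - a * p ^+ j) * (1 - p ^+ j.+1 / a) != 0) -> l != 0).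
Proof.
move=> a0; pose z j : C := - (a * p ^+ j) - p ^+ j.+1 / a + p ^+ j * p ^+ j.+1.
have zE j : (1 - a * p ^+ j) * (1 - p ^+ j.+1 / a) = 1 + z j by rewrite /z; field.
have np := nm_ge0 p; have na := nm_ge0 a.
have zb j : nm (z j) <= (nm a + nm p / nm a + 1) * nm p ^+ j.
  rewrite /z; apply: le_trans (nmD _ _) _; rewrite mulrDl; apply: lerD.
    apply: le_trans (nmB _ _) _; rewrite mulrDl nmN !normcM normcV !nmX exprS.
    by rewrite lerD2l mulrAC.
  rewrite mul1r normcM !nmX ler_piMr ?exprn_ge0 //.
  by rewrite exprn_ile1 // ltW.
have [l hl] := prod_cvg r01 zb.
have E : (fun m => \prod_(j < m) (1 + z j)) = theta_partial p a.
  by apply/funext => m; apply: eq_bigr => j _; rewrite zE.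
exists l => [|h]; first by rewrite -E.
by apply: (prod_lim_neq0 r01 zb) hl => j; rewrite -zE.
Qed.

Lemma theta_lim a : a != 0 -> theta_partial p a @ \oo --> theta a p.
Proof.
move=> a0; have [l hl _] := theta_partial_cvg a0.
by have -> : theta a p = l by apply: seq_lim.
Qed.

Lemma theta1 : theta (1 : C) p = 0.
Proof.
apply: seq_lim; apply/cvg_normcP => e e0; exists 1%N => -[//|m] _.
by rewrite big_ord_recl /= expr0 mulr1 subrr !mul0r subrr normc0.
Qed.

(** A convergent product of this kind vanishes only if one of its factors
    does. *)
Lemma theta_zero a : a != 0 -> theta a p = 0 ->
  exists j, a * p ^+ j = 1 \/ a = p ^+ j.+1.
Proof.
move=> a0 t0; have [l hl l0] := theta_partial_cvg a0.
have lE : l = 0 by rewrite -t0; apply: (seq_cvg_unique hl); exact: theta_lim.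
apply: contrapT => no; suff : l != 0 by rewrite lE eqxx.
apply: l0 => j; apply/negP; rewrite mulf_eq0 !subr_eq0 => /orP[/eqP E|/eqP E]; apply: no; exists j.
  by left.
by right; rewrite -[LHS]mul1r E divfK.
Qed.

Lemma theta_pow a i j : p != 0 -> a * p ^+ i = p ^+ j -> theta a p = 0.
Proof.
move=> p0 E; have pn k : p ^+ k != 0 by rewrite expf_neq0.
have [ij|ji] := ltnP i j.
  have aE : a = p ^+ (j - i.+1).+1.
    have jE : j = ((j - i.+1).+1 + i)%N by lia.
    by apply: (mulIf (pn i)); rewrite E {1}jE exprD.
  apply: seq_lim; apply/cvg_normcP => e e0; exists (j - i.+1).+1 => m jm.
  by rewrite (bigD1 (Ordinal jm)) //= aE divff // subrr mulr0 mul0r subrr normc0.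
have aE : a * p ^+ (i - j) = 1.
  by apply: (mulIf (pn j)); rewrite mul1r -{2}E -{2}(subnK ji) exprD mulrA.
apply: seq_lim; apply/cvg_normcP => e e0; exists (i - j).+1 => m jm.
by rewrite (bigD1 (Ordinal jm)) //= aE subrr !mul0r subrr normc0.
Qed.

Lemma theta_zeroP a : a != 0 -> theta a p = 0 -> exists i j, a * p ^+ i = p ^+ j.
Proof.
move=> a0 /(theta_zero a0)[j [E|E]].
  by exists j, 0%N; rewrite expr0.
by exists 0%N, j.+1; rewrite expr0 mulr1.
Qed.

(** The zeros of theta are the integral powers of p. If u q^m and u q^m' were
    both zeros, then so would be q^(m'-m), against the hypothesis. *)
Lemma theta_generic (q u : C) : q != 0 -> u != 0 -> (forall k, theta (q * q ^+ k) p != 0) ->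
  exists M, forall m, (M <= m)%N -> theta (u * q ^+ m) p != 0.
Proof.
move=> q0 u0 hq; have un k : u * q ^+ k != 0 by rewrite mulf_neq0 ?expf_neq0.
have [[m0 z0]|no] := pselect (exists m, theta (u * q ^+ m) p = 0); last first.
  by exists 0%N => m _; apply/eqP => z; apply: no; exists m.
exists m0.+1 => m lt; apply/eqP => z1; have := hq (m - m0.+1)%N.
have qE : u * q ^+ m = q * q ^+ (m - m0.+1) * (u * q ^+ m0).
  rewrite -exprS mulrCA -exprD; congr (_ * _ ^+ _); lia.
have [p0|p0] := eqVneq p 0.
  have one k : theta (u * q ^+ k) p = 0 -> u * q ^+ k = 1.
    move=> /(theta_zero (un k))[[|j] [E|E]]; move: E; rewrite p0 ?expr0 ?mulr1 ?expr0n //= ?mulr0.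
    - by move=> E; have := un k; rewrite E eqxx.
    - by move/eqP; rewrite eq_sym oner_eq0.
    - by move=> E; have := un k; rewrite E eqxx.
  move: (one _ z1); rewrite qE (one _ z0) mulr1 => ->; by rewrite theta1 eqxx.
have [i0 [j0 E0]] := theta_zeroP (un m0) z0.
have [i1 [j1 E1]] := theta_zeroP (un m) z1.
rewrite (@theta_pow _ (j0 + i1) (j1 + i0)) ?eqxx //.
by rewrite !exprD -E0 -E1 qE; ring.
Qed.

(** The partial products at 1/a and at a differ by two factors at either end,
    of which those with large index tend to 1. *)
Lemma thetaV a : a != 0 -> theta a^-1 p = - (theta a p / a).
Proof.
move=> a0; have [->|a1] := eqVneq a 1; first by rewrite invr1 theta1 mul0r oppr0.
have h1 := theta_lim a0; have h2 := theta_lim (invr_neq0 a0).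
(* Both sides are the product of (1 - a p^j) (1 - p^j / a) over 0 <= j <= m. *)
have E m : theta_partial p a^-1 m * ((1 - a) * (1 - p ^+ m / a)) = theta_partial p a m * ((1 - a^-1) * (1 - a * p ^+ m)).
  rewrite /theta_partial; elim: m => [|m IH].
    by rewrite !big_ord0 !expr0; field.
  rewrite !big_ord_recr /=; set P := \prod_(i < m) _ in IH *; set Q := \prod_(i < m) _ in IH *.
  transitivity ((P * ((1 - a) * (1 - p ^+ m / a))) * ((1 - p ^+ m.+1 * a) * (1 - p ^+ m.+1 / a))).
    by rewrite invrK; ring.
  by rewrite IH; ring.
have c k : (fun m => 1 - k * p ^+ m) @ \oo --> (1 : C).
  apply/cvg_normcP => e e0; have [J hJ] := geo_eventually (nm k) r01 e0.
  by exists J => m /hJ; rewrite opprB addrC subrK normcM nmX.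
have L1 := seq_cvgM h2 (seq_cvgM (seq_cvg_cst (fun=> erefl (1 - a))) (c a^-1)).
have L2 := seq_cvgM h1 (seq_cvgM (seq_cvg_cst (fun=> erefl (1 - a^-1))) (c a)).
have L : theta a^-1 p * ((1 - a) * 1) = theta a p * ((1 - a^-1) * 1).
  apply: (seq_cvg_unique L1); rewrite (_ : (fun m => _) = (fun m => theta_partial p a m * ((1 - a^-1) * (1 - a * p ^+ m)))) //.
  by apply/funext => m; rewrite -E [a^-1 * _]mulrC.
have n1 : 1 - a != 0 by rewrite subr_eq0 eq_sym.
apply: (mulIf n1); rewrite !mulr1 in L; rewrite L; field; by [].
Qed.
End Theta.

(** * The addition formula *)

Section GaussProduct.
Variable K : fieldType.

Definition evens (m : nat) := [seq (i + j, i - j) | i <- window m, j <- window m].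
Definition odds (m : nat) := [seq (i + j + 1, i - j) | i <- window m, j <- window m].

Lemma gauss_term_even (s z y : K) (i j : int) : s != 0 -> z != 0 -> y != 0 ->
  gauss_term s (z * y) (i + j) * gauss_term s (z / y) (i - j) = gauss_term (s ^+ 2) (z ^+ 2) i * gauss_term (s ^+ 2) (y ^+ 2) j.
Proof.
move=> s0 z0 y0; rewrite /gauss_term !expr2 !expfzMl exprz_inv.
have e1 : s ^ ((i + j) * (i + j)) * s ^ ((i - j) * (i - j)) =
    s ^ (i * i) * s ^ (i * i) * (s ^ (j * j) * s ^ (j * j)).
  by rewrite -!expfzDr //; congr (_ ^ _); ring.
have e2 : z ^ (i + j) * z ^ (i - j) = z ^ i * z ^ i.
  by rewrite -!expfzDr //; congr (_ ^ _); ring.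
have e3 : y ^ (i + j) * y ^ (- (i - j)) = y ^ j * y ^ j.
  by rewrite -!expfzDr //; congr (_ ^ _); ring.
rewrite mulrACA [X in _ * X]mulrACA e1 e2 e3.
move: (s ^ (i * i)) (s ^ (j * j)) (z ^ i) (y ^ j) => S1 S2 Z Y; ring.
Qed.

Lemma gauss_term_odd (s z y : K) (i j : int) : s != 0 -> z != 0 -> y != 0 ->
  gauss_term s (z * y) (i + j + 1) * gauss_term s (z / y) (i - j) =
  (s * z * y) * (gauss_term (s ^+ 2) ((s * z) ^+ 2) i * gauss_term (s ^+ 2) ((s * y) ^+ 2) j).
Proof.
move=> s0 z0 y0; rewrite /gauss_term !expr2 !expfzMl exprz_inv.
have e1 : s ^ ((i + j + 1) * (i + j + 1)) * s ^ ((i - j) * (i - j)) =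
    s ^ 1 * (s ^ (i * i) * s ^ (i * i) * (s ^ i * s ^ i) * (s ^ (j * j) * s ^ (j * j) * (s ^ j * s ^ j))).
  by rewrite -!expfzDr //; congr (_ ^ _); ring.
have e2 : z ^ (i + j + 1) * z ^ (i - j) = z ^ 1 * (z ^ i * z ^ i).
  by rewrite -!expfzDr //; congr (_ ^ _); ring.
have e3 : y ^ (i + j + 1) * y ^ (- (i - j)) = y ^ 1 * (y ^ j * y ^ j).
  by rewrite -!expfzDr //; congr (_ ^ _); ring.
rewrite mulrACA [X in _ * X]mulrACA e1 e2 e3 !expr1z.
move: (s ^ (i * i)) (s ^ (j * j)) (s ^ i) (s ^ j) (z ^ i) (y ^ j) => S1 S2 S3 S4 Z Y; ring.
Qed.


Lemma gauss_box (s z y : K) m :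
  \sum_(kl <- [seq (k, l) | k <- window m, l <- window m]) gauss_term s (z * y) kl.1 * gauss_term s (z / y) kl.2 =
  (\sum_(k <- window m) gauss_term s (z * y) k) * (\sum_(l <- window m) gauss_term s (z / y) l).
Proof.
by rewrite big_allpairs_dep mulr_suml; apply: eq_bigr => k _; rewrite mulr_sumr.
Qed.

Lemma gauss_parity (s z y : K) m : s != 0 -> z != 0 -> y != 0 ->
  \sum_(kl <- evens m ++ odds m) gauss_term s (z * y) kl.1 * gauss_term s (z / y) kl.2 =
  (\sum_(k <- window m) gauss_term (s ^+ 2) (z ^+ 2) k) * (\sum_(k <- window m) gauss_term (s ^+ 2) (y ^+ 2) k) +
  s * z * y * ((\sum_(k <- window m) gauss_term (s ^+ 2) ((s * z) ^+ 2) k) *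
    (\sum_(k <- window m) gauss_term (s ^+ 2) ((s * y) ^+ 2) k)).
Proof.
move=> s0 z0 y0; rewrite big_cat /evens /odds !big_allpairs_dep !mulr_suml mulr_sumr.
congr (_ + _); apply: eq_bigr => i _; rewrite !mulr_sumr; apply: eq_bigr => j _ /=.
  exact: gauss_term_even.
exact: gauss_term_odd.
Qed.

Lemma rank2_algebra (kap s u y z g1 g2 g3 g4 l1 l2 : K) :
  l1 * l2 = g1 * g2 + s * z * y * (g3 * g4) ->
  (kap * l1) * (kap * l2) =
  kap ^+ 2 * g1 * g2 + kap ^+ 2 * (s * z) * g3 * (y * g4).
Proof. by move=> E; rewrite mulrACA E; ring. Qed.
End GaussProduct.

Section Rank2.
Local Open Scope classical_set_scope.
Variable R : realType.
Local Notation C := (Num.NumField.sort (R[i] : numFieldType)).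
Local Notation nm := (@normc R).

Lemma sum_bounded_scale (I : eqType) (w : I -> R) B A : 0 <= A -> sum_bounded w B ->
  sum_bounded (fun i => A * w i) (A * B).
Proof. by move=> A0 wB s us; rewrite -mulr_sumr ler_wpM2l //; exact: wB. Qed.

Lemma gauss_term_dominated (s z : C) : s != 0 -> nm s < 1 -> z != 0 ->
  exists w : int -> R, exists B, [/\ forall k, 0 <= w k, sum_bounded w B & forall k, nm (gauss_term s z k) <= w k].
Proof.
move=> s0 s1 z0; have [A A0 hA] := gauss_term_bound s0 s1 z0.
have r01 : 0 <= nm s < 1 by rewrite nm_ge0.
exists (fun k => A * nm s ^+ `|k|%N); eexists; split; last exact: hA.
  by move=> k; rewrite mulr_ge0 ?exprn_ge0 ?nm_ge0.
apply: sum_bounded_scale A0 _; exact: sum_bounded_int r01.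
Qed.

(** The Jacobi triple product, as the limit of [triple_finite]. *)
Lemma theta_gauss_series (p s a kap : C) K : nm p < 1 -> p != 0 -> s ^+ 2 = p -> a != 0 ->
  (forall m k, nm (triple_coeff p m k) <= K) -> (forall k, (fun m => triple_coeff p m k) @ \oo --> kap) ->
  theta a p = kap * gauss_series s (- a / s).
Proof.
move=> p1 p0 sE a0 cK ck.
have s0 : s != 0 by apply: contraNneq p0 => s0; rewrite -sE s0 expr0n.
have s1 : nm s < 1.
  have := p1; rewrite -sE nmX; apply: contraTlt => h; rewrite -leNgt exprn_ege1 //.
have z0 : - a / s != 0 by rewrite mulf_neq0 ?invr_neq0 // oppr_eq0.
have [w [B [w0 wB fw]]] := gauss_term_dominated s0 s1 z0.
have T := tannery fw wB window_uniq window_uniq mem_window_eventually mem_window_eventually cK ck.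
have L1 := theta_lim p1 a0.
have L2 := seq_cvgM (seq_cvg_cst (fun=> erefl kap)) (gauss_sum_cvg s0 s1 z0).
have L3 := seq_cvgD T L2; rewrite add0r in L3.
apply: (seq_cvg_unique L1); apply: seq_cvg_ext L3 => m.
by rewrite (triple_finite p0 (one_sub_exp_neq0 p1) m sE a0) /gauss_sum subrK.
Qed.

Lemma parity_uniq m : uniq (evens m ++ odds m).
Proof.
rewrite cat_uniq; apply/and3P; split.
- apply: allpairs_uniq; rewrite ?window_uniq // => -[i j] [k l] _ _ /= [h1 h2].
  by congr (_, _); lia.
- apply/hasPn => -[u v] /allpairsP[[i j] [_ _ [-> ->]]].
  by apply/negP => /allpairsP[[k l] [_ _ [h1 h2]]] /=; move: h1 h2 => /= ; lia.
- apply: allpairs_uniq; rewrite ?window_uniq // => -[i j] [k l] _ _ /= [h1 h2].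
  by congr (_, _); lia.
Qed.

(** Every pair (k, l) has the form (i + j, i - j) or (i + j + 1, i - j)
    according to the parity of k + l. *)
Lemma parity_cover (kl : int * int) :
  exists M, forall m, (M <= m)%N -> kl \in evens m ++ odds m.
Proof.
case: kl => k l; exists (`|k| + `|l|)%N => m hm; rewrite mem_cat.
have [h|h] : (exists i, k + l = 2 * i) \/ (exists i, k + l = 2 * i + 1).
- by case: (boolP (odd `|(k + l)%R|%N)) => h; [right; exists ((k + l - 1) %/ 2)%Z | left; exists ((k + l) %/ 2)%Z]; lia.
- have [i iE] := h; apply/orP; left; apply/allpairsP; exists (i, k - i); split => /=.
  + by rewrite mem_window; lia.
  + by rewrite mem_window; lia.
  + by congr (_, _); lia.
- have [i iE] := h; apply/orP; right; apply/allpairsP; exists (i, k - i - 1); split => /=.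
  + by rewrite mem_window; lia.
  + by rewrite mem_window; lia.
  + by congr (_, _); lia.
Qed.

(** The square window and the union of the two parity classes are two
    exhaustions of the pairs of integers, hence give the same sum; in the
    second one the variables z and y are separated. *)
Lemma gauss_series_prod (s z y : C) : s != 0 -> nm s < 1 -> z != 0 -> y != 0 ->
  gauss_series s (z * y) * gauss_series s (z / y) =
  gauss_series (s ^+ 2) (z ^+ 2) * gauss_series (s ^+ 2) (y ^+ 2) +
  (s * z * y) * (gauss_series (s ^+ 2) ((s * z) ^+ 2) * gauss_series (s ^+ 2) ((s * y) ^+ 2)).
Proof.
move=> s0 s1 z0 y0.
have zy0 : z * y != 0 by rewrite mulf_neq0.
have zv0 : z / y != 0 by rewrite mulf_neq0 ?invr_neq0.
have [w1 [B1 [w10 wB1 fw1]]] := gauss_term_dominated s0 s1 zy0.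
have [w2 [B2 [w20 wB2 fw2]]] := gauss_term_dominated s0 s1 zv0.
pose f (kl : int * int) := gauss_term s (z * y) kl.1 * gauss_term s (z / y) kl.2.
have fw kl : nm (f kl) <= w1 kl.1 * w2 kl.2.
  by rewrite /f normcM ler_pM ?nm_ge0.
pose As m := [seq (k, l) | k <- window m, l <- window m].
pose Bs m := evens m ++ odds m.
have uA m : uniq (As m) by apply: allpairs_uniq; rewrite ?window_uniq // => -[? ?] [? ?] _ _ [-> ->].
have inA kl : exists M, forall m, (M <= m)%N -> kl \in As m.
  case: kl => k l; exists (`|k| + `|l|)%N => m hm; apply/allpairsP; exists (k, l).
  by split; rewrite //= mem_window; lia.
have one (m : nat) (kl : int * int) : nm (1 : C) <= 1 by rewrite le_eqVlt (_ : nm 1 = 1) ?eqxx //; exact: normc1.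
have T := tannery fw (sum_bounded_prod w10 w20 wB1 wB2) uA parity_uniq inA parity_cover one
   (fun _ : int * int => seq_cvg_cst (fun _ : nat => erefl (1 : C))).
have s20 : s ^+ 2 != 0 by rewrite expf_neq0.
have s21 : nm (s ^+ 2) < 1 by rewrite nmX exprn_ilt1 ?nm_ge0.
have g u : u != 0 -> gauss_sum (s ^+ 2) (u ^+ 2) @ \oo --> gauss_series (s ^+ 2) (u ^+ 2).
  by move=> u0; apply: gauss_sum_cvg; rewrite // expf_neq0.
have sz0 : s * z != 0 by rewrite mulf_neq0.
have sy0 : s * y != 0 by rewrite mulf_neq0.
have LB := seq_cvgD (seq_cvgM (g _ z0) (g _ y0))
  (seq_cvgM (seq_cvg_cst (fun=> erefl (s * z * y))) (seq_cvgM (g _ sz0) (g _ sy0))).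
have LA := seq_cvgM (gauss_sum_cvg s0 s1 zy0) (gauss_sum_cvg s0 s1 zv0).
have L := seq_cvgD T LB; rewrite add0r in L.
apply: (seq_cvg_unique LA); apply: seq_cvg_ext L => m.
have -> : \sum_(i <- As m) 1 * f i = gauss_sum s (z * y) m * gauss_sum s (z / y) m.
  by rewrite -gauss_box; apply: eq_bigr => i _; rewrite mul1r.
by rewrite mul1r (gauss_parity m s0 z0 y0) subrK.
Qed.

(** The addition formula for theta in the form in which it is used: as a
    kernel in u and y, theta(u y) theta(u / y) has rank two. The square root
    of p is only available as a unit for p <> 0; for p = 0 theta(a) is 1 - a. *)
Lemma theta_rank2 (p : C) : nm p < 1 -> exists A0 A1 g0 g1 : C -> C,
  forall u y, u != 0 -> y != 0 ->
  theta (u * y) p * theta (u / y) p = A0 u * g0 y + A1 u * g1 y.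
Proof.
move=> p1; have [p0|p0] := eqVneq p 0.
  have t0 a : a != 0 -> theta a p = 1 - a.
    move=> a0; have L := theta_lim p1 a0; apply: (seq_cvg_unique L).
    apply/cvg_normcP => e e0; exists 1%N => -[//|m] _; rewrite /theta_partial big_ord_recl /= big1.
      by rewrite p0 !expr0 !expr1 mul0r subr0 !mulr1 subrr normc0.
    by move=> j _; rewrite p0 /= !expr0n /= mulr0 mul0r !subr0 mulr1.
  exists (fun u => 1 + u ^+ 2), (fun u => - u), (fun=> 1), (fun y => y + y^-1) => u y u0 y0.
  rewrite !t0 ?mulf_neq0 ?invr_neq0 //; by field.
have [kap _ [[K cK] ck]] := triple_coeff_lim p1.
pose s : C := sqrtC p.
have sE : s ^+ 2 = p by rewrite sqrtCK.
have s0 : s != 0 by apply: contraNneq p0 => s0; rewrite -sE s0 expr0n.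
have s1 : nm s < 1.
  have := p1; rewrite -sE nmX; apply: contraTlt => h; rewrite -leNgt exprn_ege1 //.
have T a a0 := theta_gauss_series p1 p0 sE a0 cK ck (a := a).
exists (fun u => kap ^+ 2 * gauss_series p ((- u / s) ^+ 2)),
  (fun u => kap ^+ 2 * (s * (- u / s)) * gauss_series p ((s * (- u / s)) ^+ 2)),
  (fun y => gauss_series p (y ^+ 2)), (fun y => y * gauss_series p ((s * y) ^+ 2)) => u y u0 y0.
rewrite !T ?mulf_neq0 ?invr_neq0 //.
have z0 : - u / s != 0 by rewrite mulf_neq0 ?invr_neq0 // oppr_eq0.
have -> : - (u * y) / s = (- u / s) * y by ring.
have -> : - (u / y) / s = (- u / s) / y by ring.
have := gauss_series_prod s0 s1 z0 y0; rewrite sE => E.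
exact: rank2_algebra E.
Qed.
End Rank2.

(** * Interpolation by forms in two functions *)

Section Interp.
Variables (F : fieldType) (g0 g1 : F -> F).

(** The binary form of degree d with coefficients p_i, evaluated at (g0 y, g1
    y). *)
Definition homog_eval d (p : {poly F}) y :=
  \sum_(i < d.+1) p`_i * g1 y ^+ i * g0 y ^+ (d - i).

Definition homog d (f : F -> F) :=
  exists2 p : {poly F}, (size p <= d.+1)%N & forall y : F, y != 0 -> f y = homog_eval d p y.

Lemma homog_const k : homog 0 (fun=> k).
Proof.
exists k%:P => [|y _]; first exact: size_polyC_leq1.
by rewrite /homog_eval big_ord1 coefC /= !expr0 !mulr1.
Qed.

Lemma homog_add d f g : homog d f -> homog d g -> homog d (fun y => f y + g y).
Proof.
move=> [p sp pE] [r sr rE]; exists (p + r) => [|y y0].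
  by rewrite (leq_trans (size_polyD _ _)) // geq_max sp sr.
rewrite pE // rE // /homog_eval -big_split /=; apply: eq_bigr => i _.
by rewrite coefD; ring.
Qed.

Lemma homog_scale d k f : homog d f -> homog d (fun y => k * f y).
Proof.
move=> [p sp pE]; exists (k *: p) => [|y y0].
  by rewrite (leq_trans (size_scale_leq _ _)).
rewrite pE // /homog_eval mulr_sumr; apply: eq_bigr => i _.
by rewrite coefZ; ring.
Qed.

Lemma homog_sum d (I : finType) (P : pred I) (f : I -> F -> F) :
  (forall i, P i -> homog d (f i)) -> homog d (fun y => \sum_(i | P i) f i y).
Proof.
move=> hf; have : forall s : seq I, homog d (fun y => \sum_(i <- s | P i) f i y).
  elim=> [|i s [p sp pE]].
    exists 0 => [|y y0]; first by rewrite size_poly0.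
    rewrite big_nil /homog_eval big1 // => i _; by rewrite coef0 !mul0r.
  have [Pi|nPi] := boolP (P i); last first.
    by exists p => // y y0; rewrite big_cons (negPf nPi) pE.
  have [r sr rE] := homog_add (hf i Pi) (ex_intro2 _ _ p sp pE).
  by exists r => // y y0; rewrite big_cons Pi rE.
by move/(_ (index_enum I)).
Qed.

Lemma homog_linear d f al be : homog d f ->
  homog d.+1 (fun y => (al * g0 y + be * g1 y) * f y).
Proof.
move=> [p sp pE]; exists (al *: p + be *: (p * 'X)) => [|y y0].
  rewrite (leq_trans (size_polyD _ _)) // geq_max.
  rewrite (leq_trans (size_scale_leq _ _)) 1?(leq_trans sp) //=.
  rewrite (leq_trans (size_scale_leq _ _)) // (leq_trans (size_polyMleq _ _)) //.
  by rewrite size_polyX addn2.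
rewrite pE // /homog_eval.
under [RHS]eq_bigr => i _.
  rewrite coefD !coefZ coefMX.
  rewrite (_ : _ * _ * _ = al * (p`_i * g1 y ^+ i * g0 y ^+ (d.+1 - i)) +
     be * ((if i == 0 :> nat then 0 else p`_i.-1) * g1 y ^+ i * g0 y ^+ (d.+1 - i))); last by rewrite !mulrDl !mulrA.
  over.
rewrite big_split /= -!mulr_sumr mulrDl.
congr (_ + _).
  rewrite [in RHS]big_ord_recr /= (@nth_default _ 0 p d.+1 sp) !mul0r addr0 -mulrA; congr (_ * _).
  rewrite mulr_sumr; apply: eq_bigr => i _.
  rewrite subSn; last by rewrite -ltnS.
  by rewrite exprS; ring.
rewrite [in RHS]big_ord_recl /= !mul0r add0r -mulrA; congr (_ * _).
rewrite mulr_sumr; apply: eq_bigr => i _ /=.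
by rewrite /bump /= add1n subSS exprS; ring.
Qed.

Definition linform (f : F -> F) :=
  exists al be, forall y : F, y != 0 -> f y = al * g0 y + be * g1 y.

Lemma homog_eq d f g : (forall y : F, y != 0 -> f y = g y) -> homog d g -> homog d f.
Proof. by move=> fg [p sp pE]; exists p => // y y0; rewrite fg // pE. Qed.

(** Products of d linear forms, recorded by their coefficients, so that
    degrees add under multiplication. *)
Definition linprod d (f : F -> F) :=
  exists2 s : seq (F * F), size s = d &
    forall y : F, y != 0 -> f y = \prod_(v <- s) (v.1 * g0 y + v.2 * g1 y).

Lemma linprodM d e f g :
  linprod d f -> linprod e g -> linprod (d + e) (fun y => f y * g y).
Proof.
move=> [s ss sE] [t st tE]; exists (s ++ t); first by rewrite size_cat ss st.
by move=> y y0; rewrite sE // tE // big_cat.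
Qed.

Lemma linprod1 : linprod 0 (fun=> 1).
Proof. by exists [::] => // y _; rewrite big_nil. Qed.

Lemma linprod_lin f : linform f -> linprod 1 f.
Proof.
by move=> [al [be fE]]; exists [:: (al, be)] => // y y0; rewrite big_seq1 fE.
Qed.

Lemma linprod_ext d f g : (forall y : F, y != 0 -> f y = g y) ->
  linprod d g -> linprod d f.
Proof. by move=> fg [s ss sE]; exists s => // y y0; rewrite fg // sE. Qed.

Lemma linprod_ord n (f : nat -> F -> F) :
  (forall i, linform (f i)) -> linprod n (fun y => \prod_(i < n) f i y).
Proof.
move=> hf; elim: n => [|n IHn].
  by apply: linprod_ext linprod1 => y _; rewrite big_ord0.
rewrite -addn1; apply: linprod_ext (linprodM IHn (linprod_lin (hf n))) => y _.
by rewrite addn1 big_ord_recr.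
Qed.

Lemma linprod_prod (I : finType) (d : I -> nat) (f : I -> F -> F) :
  (forall i, linprod (d i) (f i)) ->
  linprod (\sum_i d i) (fun y => \prod_i f i y).
Proof.
move=> hf; have : forall s : seq I,
    linprod (\sum_(i <- s) d i) (fun y => \prod_(i <- s) f i y).
  elim=> [|i s IHs].
    by rewrite big_nil; apply: linprod_ext linprod1 => y _; rewrite big_nil.
  by rewrite big_cons; apply: linprod_ext (linprodM (hf i) IHs) => y _; rewrite big_cons.
by move/(_ (index_enum I)).
Qed.

Lemma homog_linprod d f k : linprod d f -> homog d (fun y => k * f y).
Proof.
move=> [s <- sE]; apply: (@homog_eq _ _ (fun y => k * \prod_(v <- s) (v.1 * g0 y + v.2 * g1 y))).
  by move=> y y0; rewrite sE.
apply: homog_scale; elim: s {sE} => [|v s IHs] /=.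
  by apply: homog_eq (homog_const 1) => y _; rewrite big_nil.
by apply: homog_eq (homog_linear v.1 v.2 IHs) => y _; rewrite big_cons.
Qed.

Lemma homog_eval_dehom d (p : {poly F}) y : g0 y != 0 -> (size p <= d.+1)%N ->
  homog_eval d p y = g0 y ^+ d * p.[g1 y / g0 y].
Proof.
move=> g0y sp; rewrite (horner_coef_wide _ sp) /homog_eval mulr_sumr.
apply: eq_bigr => i _; rewrite expr_div_n.
have -> : g0 y ^+ d = g0 y ^+ (d - i) * g0 y ^+ i.
  by rewrite -exprD subnK // -ltnS.
by field; rewrite expf_neq0.
Qed.

(** Divided by g0^d, the form is a polynomial in g1 / g0 of degree at most d.
    By distinctness at most one node has g0 = 0, and such a node forces the
    leading coefficient to vanish, so the d remaining roots still suffice. *)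
Lemma homog_zero d f (I : finType) (t : I -> F) :
    homog d f -> (d < #|I|)%N -> (forall i, t i != 0) -> (forall i, f (t i) = 0) ->
    (forall i j, i != j -> g0 (t i) * g1 (t j) - g1 (t i) * g0 (t j) != 0) ->
  forall y : F, y != 0 -> f y = 0.
Proof.
move=> [p sp pE] dI t0 ft0 tdet.
suff p0 : p = 0.
  by move=> y y0; rewrite pE // p0 /homog_eval big1 // => i _; rewrite coef0 !mul0r.
pose A := [set i | g0 (t i) != 0].
have rho_inj : {in A &, injective (fun i => g1 (t i) / g0 (t i))}.
  move=> i j; rewrite !inE => gi gj /eqP; apply: contraTeq => ij.
  apply: contra (tdet _ _ ij) => /eqP E.
  have -> : g1 (t i) = g1 (t j) / g0 (t j) * g0 (t i) by rewrite -E divfK.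
  by apply/eqP; field.
have rootA : all (root p) [seq g1 (t i) / g0 (t i) | i in A].
  apply/allP => z /mapP[i iA ->{z}]; have gi : g0 (t i) != 0 by move: iA; rewrite mem_enum inE.
  have := ft0 i; rewrite pE // homog_eval_dehom // => /eqP; rewrite mulf_eq0.
  by rewrite expf_eq0 (negPf gi) andbF.
have uniqA : uniq [seq g1 (t i) / g0 (t i) | i in A].
  by rewrite map_inj_in_uniq ?enum_uniq // => i j; rewrite !mem_enum; apply: rho_inj.
apply/eqP; apply: contraT => p0.
have := max_poly_roots p0 rootA uniqA; rewrite size_map -cardE => ltA.
have [i0 /= i0A | allA] := pickP [pred i | i \notin A]; last first.
  have AT : A = [set: I].
    by apply/setP => i; have /negbFE := allA i; rewrite [RHS]inE.
  by move: ltA; rewrite AT cardsT ltnNge (leq_trans sp).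
have gi0 : g0 (t i0) = 0 by apply/eqP; move: i0A; rewrite inE negbK.
have A1 : A = ~: [set i0].
  apply/setP => i; rewrite !inE; have [->|ii0] := eqVneq i i0.
    by rewrite gi0 eqxx.
  apply: contra (tdet _ _ ii0) => /eqP gi.
  rewrite gi.  by rewrite gi0 !(mulr0, mul0r) subr0.
have cA : #|A| = #|I|.-1.
  by rewrite A1 cardsC1.
have pd : p`_d = 0.
  have := ft0 i0; rewrite pE // /homog_eval big_ord_recr /= subnn gi0 expr0 mulr1 big1 ?add0r.
    move/eqP; rewrite mulf_eq0 expf_eq0 => /orP[/eqP//|/andP[d0 /eqP g1i0]].
    have /card_gt1P[i [j [_ _ ij]]] : (1 < #|I|)%N by apply: leq_trans dI; rewrite ltnS.
    have [k ki0] : exists k, i0 != k.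
      by have [E|] := eqVneq i0 i; [exists j; rewrite E | exists i].
    by have := tdet _ _ ki0; rewrite gi0 g1i0 !mul0r subrr eqxx.
  by move=> i _; rewrite expr0n subn_eq0 leqNgt ltn_ord /= mulr0.
have sp' : (size p <= d)%N.
  move: sp; rewrite leq_eqVlt => /orP[/eqP sp|//].
  by move: pd => /eqP; rewrite -[d]/(d.+1.-1) -sp -lead_coefE lead_coef_eq0 (negPf p0).
move: ltA; rewrite cA ltnNge (leq_trans sp') //.
by rewrite -ltnS prednK // (leq_trans _ dI).
Qed.
End Interp.

(** * Elliptic shifted factorials *)

Section Fact.
Variables (F : fieldType) (th : F -> F) (q : F).
Hypothesis q0 : q != 0.
Hypothesis thV : forall y : F, y != 0 -> th y^-1 = - (th y / y).

Definition efact (y : F) (k : nat) : F := \prod_(i < k) th (y * q ^+ i).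

Lemma efact0 y : efact y 0 = 1. Proof. by rewrite /efact big_ord0. Qed.

Lemma efactSr y k : efact y k.+1 = efact y k * th (y * q ^+ k).
Proof. by rewrite /efact big_ord_recr. Qed.

Lemma efactD y m k : efact y (m + k) = efact y m * efact (y * q ^+ m) k.
Proof.
rewrite /efact big_split_ord /=; congr (_ * _); apply: eq_bigr => i _.
by rewrite exprD mulrA.
Qed.

Lemma efactS y k : efact y k.+1 = th y * efact (y * q) k.
Proof. by rewrite -add1n efactD /efact big_ord1 expr0 mulr1 expr1. Qed.

Lemma efact_neq0 y k : (forall i, (i < k)%N -> th (y * q ^+ i) != 0) -> efact y k != 0.
Proof. by move=> h; apply/prodf_neq0 => i _; apply: h. Qed.

Lemma qexp_neq0 k : q ^+ k != 0. Proof. by rewrite expf_neq0. Qed.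

(** Reflecting (1/(X q^i))_j and (1/(X q^(i+D)))_j into factorials with base X
    gives two overlapping blocks of consecutive factors; the powers of q
    created by theta(1/y) = -theta(y)/y combine to q^(Dj). *)
Lemma efact_reflect X i D j : X != 0 ->
  efact (X * q ^+ i)^-1 j * efact (X * q ^+ i.+1) D =
  q ^+ (D * j) * efact (X * q ^+ (i + D))^-1 j * efact (X * q ^+ i.+1 / q ^+ j) D.
Proof.
move=> X0; elim: j => [|j IHj].
  by rewrite !efact0 muln0 !expr0 !mul1r divr1.
rewrite !efactSr mulrAC IHj.
(* One block of D + 1 consecutive factors, split at its last and at its first factor. *)
have shift : efact (X * q ^+ i.+1 / q ^+ j.+1) D * th (X * q ^+ (i + D) / q ^+ j) =
   th (X * q ^+ i / q ^+ j) * efact (X * q ^+ i.+1 / q ^+ j) D.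
  have e1 : X * q ^+ (i + D) / q ^+ j = X * q ^+ i.+1 / q ^+ j.+1 * q ^+ D.
    by rewrite exprD !exprS; field; rewrite q0 qexp_neq0.
  have e2 : X * q ^+ i / q ^+ j = X * q ^+ i.+1 / q ^+ j.+1.
    by rewrite !exprS; field; rewrite q0 qexp_neq0.
  have e3 : X * q ^+ i.+1 / q ^+ j = X * q ^+ i.+1 / q ^+ j.+1 * q.
    by rewrite !exprS; field; rewrite q0 qexp_neq0.
  by rewrite e1 e2 e3 -efactSr efactS.
have inv k : th ((X * q ^+ k)^-1 * q ^+ j) =
    - (th (X * q ^+ k / q ^+ j) / (X * q ^+ k / q ^+ j)).
  rewrite -thV; last by rewrite !mulf_neq0 ?invr_eq0 ?qexp_neq0.
  by rewrite invf_div mulrC.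
rewrite !inv.
have -> : q ^+ (D * j.+1) = q ^+ (D * j) * q ^+ D by rewrite mulnS addnC exprD.
set A := efact (X * q ^+ (i + D))^-1 j; set B := efact _ D; set B' := efact _ D in shift *.
set C := q ^+ (D * j).
transitivity (- (C * A * (th (X * q ^+ i / q ^+ j) * B) / (X * q ^+ i / q ^+ j))).
  by field; rewrite !qexp_neq0 X0.
rewrite -shift exprD; field; rewrite !qexp_neq0 X0 //.
Qed.
End Fact.

(** * Factors of the summand *)

Section Factors.
Variables (F : fieldType) (th : F -> F) (q a : F).
Hypothesis q0 : q != 0.
Hypothesis a0 : a != 0.
Hypothesis thV : forall y : F, y != 0 -> th y^-1 = - (th y / y).
Notation efact := (efact th q).

(** The part of the summand attached to an unordered pair of indices: X, Y
    stand for x_r, x_s and i, j for the entries of the multi-index. *)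
Definition pair_factor X Y i j := th (a * X * Y * q ^+ (i + j)) / th (a * X * Y) * q ^+ (i * j).
(** The part attached to an ordered pair of indices, where M, N are the upper
    bounds for i, j. *)
Definition ordered_factor X Y M N i j :=
  efact (a * X * Y) i / (efact (q * X / Y) i * efact (q ^+ i.+1 / q ^+ j * X / Y) (M - i) *
     efact (a * X * Y * q) (N + i)).
(** The factors (uX)_j / (aqX/u)_j of a parameter u, multiplied by (aqX/u)_N
    to be free of denominators. *)
Definition param_factor u X N j := efact (u * X) j * efact (a * q ^+ j.+1 * X / u) (N - j).
Definition site_factor B d e X N j :=
  X ^- j * (th (a * X ^+ 2 * q ^+ (2 * j)) / th (a * X ^+ 2)) *
  (efact (B / q ^+ N / (a * X)) (N - j) * efact (B * X) j) *
  (param_factor d X N j * param_factor e X N j).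

Definition generic_pair X Y := [/\ X != 0, Y != 0, (forall k, th (a * X * Y * q ^+ k) != 0) &
   (forall k l, th (X / Y * q ^+ k / q ^+ l) != 0)].

Lemma generic_pair_efact X Y k l m : (forall k l, th (X / Y * q ^+ k / q ^+ l) != 0) ->
  efact (X / Y * q ^+ k / q ^+ l) m != 0.
Proof.
move=> h; apply: efact_neq0 => i _; have := h (k + i)%N l.
by congr (th _ != 0); rewrite exprD; ring.
Qed.

(** At c = 1/(X q^i) the factor of c moves the upper bound of the index of X
    from i + D down to i. The ratio does not depend on j except for the power
    q^(Dj), which compensates the change of b. *)
Lemma trunc_cross X Y i D N k j :
  generic_pair X Y -> generic_pair Y X -> (k <= i)%N -> (j <= N)%N ->
  param_factor (X * q ^+ i)^-1 Y N j * ordered_factor X Y (i + D) N k j * ordered_factor Y X N (i + D) j k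
   / q ^+ (D * j) =
  (efact (X / Y * q ^+ i.+1) D * efact (a * Y * X * q ^+ (i.+1 + N)) D)^-1 *
  (param_factor (X * q ^+ (i + D))^-1 Y N j * ordered_factor X Y i N k j * ordered_factor Y X N i j k).
Proof.
move=> [X0 Y0 hXY hX] [_ _ hYX hY] ki jN.
rewrite /param_factor /ordered_factor.
have nX k' l m := generic_pair_efact k' l m hX.
have nY k' l m := generic_pair_efact k' l m hY.
have nA k' m : efact (a * X * Y * q ^+ k') m != 0.
  by apply: efact_neq0 => i' _; have := hXY (k' + i')%N; rewrite exprD mulrA.
have qn := qexp_neq0 q0.
have XY0 : X / Y != 0 by rewrite mulf_neq0 ?invr_eq0.
have R := efact_reflect q0 thV i D j XY0.
have e1 : (X * q ^+ i)^-1 * Y = (X / Y * q ^+ i)^-1 by field; rewrite ?oner_eq0 ?X0 ?Y0 ?qn.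
have e2 : (X * q ^+ (i + D))^-1 * Y = (X / Y * q ^+ (i + D))^-1 by field; rewrite ?oner_eq0 ?X0 ?Y0 ?qn.
pose y := a * Y * X * q ^+ i.+1.
have e3 : a * q ^+ j.+1 * Y / (X * q ^+ i)^-1 = y * q ^+ j.
  by rewrite /y !exprS; field; rewrite ?oner_eq0 ?X0 ?qn.
have e4 : a * q ^+ j.+1 * Y / (X * q ^+ (i + D))^-1 = y * q ^+ (j + D).
  by rewrite /y !exprS !exprD; field; rewrite ?oner_eq0 ?X0 ?qn.
have R2 : efact (y * q ^+ j) (N - j) * efact (y * q ^+ N) D =
    efact (y * q ^+ j) D * efact (y * q ^+ (j + D)) (N - j).
  have -> : y * q ^+ N = y * q ^+ j * q ^+ (N - j) by rewrite -[in LHS](subnKC jN) exprD mulrA.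
  by rewrite [q ^+ (j + D)]exprD [y * (_ * _)]mulrA -!efactD addnC.
have R3 : efact (q ^+ k.+1 / q ^+ j * X / Y) (i + D - k) =
    efact (q ^+ k.+1 / q ^+ j * X / Y) (i - k) * efact (X / Y * q ^+ i.+1 / q ^+ j) D.
  rewrite addnC -addnBA // addnC efactD; congr (_ * efact _ _).
  rewrite -[in RHS](subnKC ki) -addSn exprD; field; rewrite ?oner_eq0 ?Y0 ?qn //.
have R4 : efact (a * Y * X * q) (i + D + j) = efact (a * Y * X * q) (i + j) * efact (y * q ^+ j) D.
  rewrite addnAC efactD; congr (_ * efact _ _).
  by rewrite /y exprD !exprS; ring.
have e5 : a * Y * X * q ^+ (i.+1 + N) = y * q ^+ N by rewrite exprD mulrA.
rewrite e1 e2 e3 e4 e5 R3 R4.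
have nR3 : efact (q ^+ k.+1 / q ^+ j * X / Y) (i - k) != 0.
  have -> : q ^+ k.+1 / q ^+ j * X / Y = X / Y * q ^+ k.+1 / q ^+ j by field; rewrite ?oner_eq0 ?Y0 ?qn.
  exact: nX.
have n1 : efact (q * X / Y) k != 0.
  have -> : q * X / Y = X / Y * q ^+ 1 / q ^+ 0 by field; rewrite ?oner_eq0 ?Y0.
  exact: nX.
have n2 : efact (q * Y / X) j != 0.
  have -> : q * Y / X = Y / X * q ^+ 1 / q ^+ 0 by field; rewrite ?oner_eq0 ?X0.
  exact: nY.
have n3 : efact (q ^+ j.+1 / q ^+ k * Y / X) (N - j) != 0.
  have -> : q ^+ j.+1 / q ^+ k * Y / X = Y / X * q ^+ j.+1 / q ^+ k by field; rewrite ?oner_eq0 ?X0 ?qn.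
  exact: nY.
have n4 : efact (a * X * Y * q) (N + k) != 0 by exact: (nA 1%N).
have yE m : y * q ^+ m = a * X * Y * q ^+ (i.+1 + m) by rewrite /y exprD; ring.
have n5 : efact (a * Y * X * q) (i + j) != 0 by rewrite [a * Y * X]mulrAC; exact: (nA 1%N).
have n6 : efact (y * q ^+ j) D != 0 by rewrite yE.
have n7 : efact (y * q ^+ N) D != 0 by rewrite yE.
have n8 : efact (X / Y * q ^+ i.+1) D != 0 by have := nX i.+1 0%N D; rewrite divr1.
have n9 : efact (X / Y * q ^+ i.+1 / q ^+ j) D != 0 by exact: nX.
move: R R2 nR3 n1 n2 n3 n4 n5 n6 n7 n8 n9 (qn (D * j)%N).
set t1 := efact (X / Y * q ^+ i)^-1 j; set t2 := efact (X / Y * q ^+ i.+1) D.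
set t3 := q ^+ (D * j); set t4 := efact (X / Y * q ^+ (i + D))^-1 j.
set t5 := efact (X / Y * q ^+ i.+1 / q ^+ j) D; set t6 := efact (y * q ^+ j) (N - j).
set t7 := efact (y * q ^+ N) D; set t8 := efact (y * q ^+ j) D.
set t9 := efact (y * q ^+ (j + D)) (N - j).
move=> R R2 *.
have -> : t1 = t3 * t4 * t5 / t2 by rewrite -R mulfK.
have -> : t6 = t8 * t9 / t7 by rewrite -R2 mulfK.
by field; do ?[apply/andP; split].
Qed.

(** At c = a q^D X, where the index of X is forced to be D, the factors that
    still involve j telescope and turn into those of an index of X bounded by
    0. *)
Lemma sat_cross X Y D N j :
  generic_pair X Y -> generic_pair Y X -> (j <= N)%N ->
  param_factor (a * q ^+ D * X) Y N j * pair_factor X Y D j * ordered_factor X Y D N D j * ordered_factor Y X N D j D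
   / q ^+ (D * j) =
  (efact (q * X / Y) D * efact (a * Y * X * q ^+ N.+1) D)^-1 *
  (param_factor (a * X) Y N j * pair_factor X Y 0 j * ordered_factor X Y 0 N 0 j * ordered_factor Y X N 0 j 0).
Proof.
move=> [X0 Y0 hXY hX] [_ _ hYX hY] jN.
rewrite /param_factor /pair_factor /ordered_factor !subnn ?subn0 !efact0 !add0n !addn0 mul0n expr0.
have nX k' l m := generic_pair_efact k' l m hX.
have nY k' l m := generic_pair_efact k' l m hY.
have nA k' m : efact (a * X * Y * q ^+ k') m != 0.
  by apply: efact_neq0 => i' _; have := hXY (k' + i')%N; rewrite exprD mulrA.
have qn := qexp_neq0 q0.
rewrite [a * Y * X]mulrAC; set y := a * X * Y.
have e1 : a * q ^+ D * X * Y = y * q ^+ D by rewrite /y; ring.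
have e2 : a * q ^+ j.+1 * Y / (a * q ^+ D * X) = q ^+ j.+1 / q ^+ D * Y / X.
  by field; rewrite ?oner_eq0 ?a0 ?X0 ?qn.
have e3 : a * q ^+ j.+1 * Y / (a * X) = q ^+ j.+1 / 1 * Y / X.
  by field; rewrite ?oner_eq0 ?a0 ?X0.
have R5 : efact (y * q) (N + D) = efact (y * q) N * efact (y * q ^+ N.+1) D.
  by rewrite efactD exprS mulrA.
(* Both sides are the factorial of y of length D + j + 1. *)
have R6 : efact y D * efact (y * q ^+ D) j * th (y * q ^+ (D + j)) = th y * efact (y * q) (D + j).
  by rewrite -efactD -efactSr efactS.
have R7 : efact y j * th (y * q ^+ j) = th y * efact (y * q) j by rewrite -efactSr efactS.
have n0 : th y != 0 by have := hXY 0%N; rewrite mulr1.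
have n1 : efact (q * X / Y) D != 0.
  have -> : q * X / Y = X / Y * q ^+ 1 / q ^+ 0 by field; rewrite ?oner_eq0 ?Y0.
  exact: nX.
have n2 : efact (q * Y / X) j != 0.
  have -> : q * Y / X = Y / X * q ^+ 1 / q ^+ 0 by field; rewrite ?oner_eq0 ?X0.
  exact: nY.
have n3 k : efact (q ^+ j.+1 / q ^+ k * Y / X) (N - j) != 0.
  have -> : q ^+ j.+1 / q ^+ k * Y / X = Y / X * q ^+ j.+1 / q ^+ k.
    by field; rewrite ?oner_eq0 ?X0 ?qn.
  exact: nY.
have n4 m : efact (y * q) m != 0 by exact: (nA 1%N).
have n5 : efact (y * q ^+ N.+1) D != 0 by [].
rewrite e1 e2 e3 R5.
have n6 : efact (q ^+ j.+1 / 1 * Y / X) (N - j) != 0 by exact: (n3 0%N).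
have n7 : efact y D != 0 by have := nA 0%N D; rewrite mulr1.
have n8 : efact y j != 0 by have := nA 0%N j; rewrite mulr1.
have n9 : efact (y * q ^+ D) j != 0 by exact: nA.
move: R6 R7 n0 n1 n2 (n3 D) n6 (n4 N) (n4 (D + j)%N) (n4 j) n5 (qn (D * j)%N) n7 n8 n9.
set t1 := efact y D; set t2 := efact (y * q ^+ D) j; set t3 := th (_ * q ^+ (D + j)).
set t4 := th y; set t5 := efact (y * q) (D + j); set t6 := efact y j; set t7 := th (y * q ^+ j).
set t8 := efact (y * q) j; set t9 := efact (q ^+ j.+1 / q ^+ D * Y / X) (N - j).
set t10 := efact (_ / 1 * Y / X) (N - j).
move=> R6 R7 *.
have -> : t3 = t4 * t5 / (t1 * t2) by rewrite -R6 mulrC mulKf // mulf_neq0.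
have -> : t7 = t4 * t8 / t6 by rewrite -R7 mulrC mulKf.
by field; do ?[apply/andP; split].
Qed.

Lemma efact_q_neq0 (hq : forall k, th (q * q ^+ k) != 0) m : efact q m != 0.
Proof. by apply: efact_neq0. Qed.

Lemma trunc_site X B d e i D k :
  X != 0 -> d != 0 -> e != 0 -> (forall k, th (q * q ^+ k) != 0) ->
  (forall k, th (a * X * X * q ^+ k) != 0) -> (k <= i)%N ->
  param_factor (X * q ^+ i)^-1 X (i + D) k * ordered_factor X X (i + D) (i + D) k k *
    site_factor B d e X (i + D) k / q ^+ (D * k) =
  (efact (q ^+ i.+1) D)^-1 *
  (efact (B / q ^+ (i + D) / (a * X)) D * efact (a * q ^+ i.+1 * X / d) D *
   efact (a * q ^+ i.+1 * X / e) D) *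
  (param_factor (X * q ^+ (i + D))^-1 X i k * ordered_factor X X i i k k * site_factor B d e X i k).
Proof.
move=> X0 d0 e0 hq hA ki; rewrite /param_factor /ordered_factor /site_factor.
have qn := qexp_neq0 q0.
have nA k' m : efact (a * X * X * q ^+ k') m != 0.
  by apply: efact_neq0 => i' _; have := hA (k' + i')%N; rewrite exprD mulrA.
have nq m : efact q m != 0 by apply: efact_q_neq0.
have nqi m l : efact (q ^+ m.+1) l != 0.
  by apply: efact_neq0 => i' _; rewrite -exprD addSn exprS.
have R := efact_reflect q0 thV i D k (oner_neq0 F); rewrite !mul1r in R.
have e1 m : (X * q ^+ m)^-1 * X = (q ^+ m)^-1 by field; rewrite ?oner_eq0 ?X0 ?qn.
have e2 : q * X / X = q by rewrite mulfK.
have e3 : q ^+ k.+1 / q ^+ k * X / X = q by rewrite mulfK // exprS mulfK.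
have iD : (i + D - k = (i - k) + D)%N by lia.
have iD' : (i + D - k = D + (i - k))%N by lia.
have split_top u : efact (u * q ^+ k) (i + D - k) = efact (u * q ^+ k) (i - k) * efact (u * q ^+ i) D.
  rewrite iD efactD; congr (_ * efact _ _).
  by rewrite -mulrA -exprD subnKC.
pose y := a * X * X * q.
have e4 m : a * q ^+ k.+1 * X / (X * q ^+ m)^-1 = y * q ^+ (m + k).
  by rewrite /y !exprS exprD; field; rewrite ?oner_eq0 ?X0 ?qn.
have e5 u : u != 0 -> a * q ^+ k.+1 * X / u = (a * q * X / u) * q ^+ k.
  by move=> u0; rewrite !exprS; field; rewrite ?oner_eq0.
have e6 u : u != 0 -> a * q ^+ i.+1 * X / u = (a * q * X / u) * q ^+ i.
  by move=> u0; rewrite !exprS; field; rewrite ?oner_eq0.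
have e7 : efact (B / q ^+ (i + D) / (a * X)) (i + D - k) =
   efact (B / q ^+ (i + D) / (a * X)) D * efact (B / q ^+ i / (a * X)) (i - k).
  rewrite iD' efactD; congr (_ * efact _ _).
  by rewrite exprD; field; rewrite ?oner_eq0 ?qn ?a0 ?X0.
have e8 : efact q (i + D - k) = efact q (i - k) * efact (q ^+ i.+1 / q ^+ k) D.
  rewrite iD efactD; congr (_ * efact _ _).
  rewrite -[in RHS](subnKC ki) -addSn exprD exprS; field; by rewrite ?oner_eq0 ?qn.
have e9 : efact (y * q ^+ (i + k)) (i + D - k) = efact (y * q ^+ (i + k)) D * efact (y * q ^+ (i + D + k)) (i - k).
  rewrite iD' efactD; congr (_ * efact _ _).
  by rewrite -mulrA -exprD addnAC.
have e10 : efact y (i + D + k) = efact y (i + k) * efact (y * q ^+ (i + k)) D by rewrite addnAC efactD.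
rewrite /param_factor !e1 !e2 !e3 !e4 (e5 d) // (e5 e) // (e6 d) // (e6 e) // e7 !split_top e8 e9 -/y e10.
have n1 := nq k; have n2 := nq (i - k)%N; have n3 : efact (q ^+ i.+1 / q ^+ k) D != 0.
  have -> : q ^+ i.+1 / q ^+ k = q ^+ (i - k).+1.
    by rewrite -subSn // expfB // ltnS.
  exact: nqi.
have n4 : efact y (i + k) != 0 by exact: (nA 1%N).
have n5 : efact (y * q ^+ (i + k)) D != 0.
  have -> : y * q ^+ (i + k) = a * X * X * q ^+ (i + k).+1 by rewrite exprS mulrA.
  exact: nA.
have n6 := nqi i D; have n7 := qn (D * k)%N.
set W := X ^- k * _; move: R.
set t1 := efact (q ^- i) k; set t2 := efact (q ^- (i + D)) k => R.
have -> : t1 = q ^+ (D * k) * t2 * efact (q ^+ i.+1 / q ^+ k) D / efact (q ^+ i.+1) D.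
  by rewrite -R mulfK.
by field; do ?[apply/andP; split].
Qed.

Lemma sat_site X B d e D :
  X != 0 -> d != 0 -> e != 0 -> (forall k, th (q * q ^+ k) != 0) ->
  (forall k, th (a * X * X * q ^+ k) != 0) ->
  param_factor (a * q ^+ D * X) X D D * ordered_factor X X D D D D * site_factor B d e X D D =
  X ^- D * (efact q D)^-1 * (efact (B * X) D * efact (d * X) D * efact (e * X) D) *
  (param_factor (a * X) X 0 0 * ordered_factor X X 0 0 0 0 * site_factor B d e X 0 0).
Proof.
move=> X0 d0 e0 hq hA; rewrite /site_factor /param_factor /ordered_factor !subnn !efact0 !(mulr1, mul1r, invr1, expr0).
have qn := qexp_neq0 q0.
have nq m : efact q m != 0 by apply: efact_q_neq0.
have nA m : efact (a * X * X * q) m != 0.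
  by apply: efact_neq0 => i _; have := hA i.+1; rewrite exprS mulrA.
have n0 : th (a * X * X) != 0 by have := hA 0%N; rewrite mulr1.
rewrite !expr2 !mulrA (mulfK X0 q).
set y := a * X * X.
have e1 : a * q ^+ D * X * X = y * q ^+ D by rewrite /y; ring.
have R : efact y D * efact (y * q ^+ D) D * th (y * q ^+ (2 * D)) = th y * efact (y * q) (D + D).
  by rewrite -efactD mul2n -addnn -efactSr efactS.
have n1 : efact y D != 0.
  by apply: efact_neq0 => i _; apply: hA.
have n2 : efact (y * q ^+ D) D != 0.
  by apply: efact_neq0 => i _; have := hA (D + i)%N; rewrite exprD mulrA.
have n3 := nA (D + D)%N; have n4 := nq D; have n5 : X ^+ D != 0 by rewrite expf_neq0.
rewrite e1; have -> : th (y * q ^+ (2 * D)) = th y * efact (y * q) (D + D) / (efact y D * efact (y * q ^+ D) D).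
  by rewrite -R [RHS]mulrC mulKf // mulf_neq0.
by field; do ?[apply/andP; split].
Qed.

Lemma pair_factorC X Y i j : pair_factor X Y i j = pair_factor Y X j i.
Proof. by rewrite /pair_factor [a * Y * X]mulrAC addnC mulnC. Qed.
End Factors.

(** * The multiple sum at the interpolation nodes *)

Section Split.
Variables (F : fieldType) (n : nat).
Implicit Types (r s : 'I_n).

(** The order of the indices is irrelevant for a symmetric function, so an
    arbitrary index r0 can be split off. *)
Lemma prod_pairs_split r0 (g : 'I_n -> 'I_n -> F) : (forall r s, g r s = g s r) ->
  \prod_(r < n) \prod_(s < n | (r < s)%N) g r s =
  (\prod_(s | s != r0) g r0 s) *
  \prod_(r < n | r != r0) \prod_(s < n | (s != r0) && (r < s)%N) g r s.
Proof.
move=> gC; rewrite (bigD1 r0) //=.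
have -> : \prod_(r < n | r != r0) \prod_(s < n | (r < s)%N) g r s =
    (\prod_(s < n | (s < r0)%N) g r0 s) *
    \prod_(r < n | r != r0) \prod_(s < n | (s != r0) && (r < s)%N) g r s.
  have -> : \prod_(s < n | (s < r0)%N) g r0 s =
      \prod_(r | r != r0) (if ((r : 'I_n) < r0)%N then g r r0 else 1).
    rewrite -big_mkcondr /=; apply: eq_big => [s|s _]; last exact: gC.
    by rewrite -val_eqE /=; case: (ltngtP s r0).
  rewrite -big_split /=; apply: eq_bigr => r _.
  rewrite [LHS](bigID (fun s : 'I_n => s == r0)) /=; congr (_ * _); last first.
    by apply: eq_bigl => s; rewrite andbC.
  case: ifP => rr0.
    rewrite (big_pred1 r0) // => s; rewrite /= andbC.
    by have [->|] := eqVneq s r0; rewrite ?rr0.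
  rewrite big_pred0 // => s; rewrite andbC.
  by have [->|] := eqVneq s r0; rewrite ?rr0.
rewrite mulrA; congr (_ * _).
rewrite [RHS](bigID (fun s : 'I_n => (r0 < s)%N)) /=; congr (_ * _); apply: eq_bigl => s.
  by rewrite -val_eqE /= andbC; case: ltngtP.
by rewrite -val_eqE /= -leqNgt; case: ltngtP.
Qed.

Lemma prod_all_split r0 (f : 'I_n -> 'I_n -> F) :
  \prod_(r < n) \prod_(s < n) f r s =
  f r0 r0 * (\prod_(s | s != r0) (f r0 s * f s r0)) *
  \prod_(r < n | r != r0) \prod_(s | s != r0) f r s.
Proof.
rewrite (bigD1 r0) //= (bigD1 r0) //= big_split /= -!mulrA; congr (_ * _).
congr (_ * _); rewrite -big_split /=; apply: eq_bigr => r _.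
by rewrite (bigD1 r0).
Qed.

Definition upd (f : 'I_n -> nat) r0 v r := if r == r0 then v else f r.

Lemma updE f r0 v : upd f r0 v r0 = v. Proof. by rewrite /upd eqxx. Qed.

Lemma updN f r0 v s : s != r0 -> upd f r0 v s = f s.
Proof. by rewrite /upd => /negPf ->. Qed.

Lemma weight_upd f r0 v D : f r0 = (v + D)%N -> weight f = (weight (upd f r0 v) + D)%N.
Proof.
move=> fE; rewrite /weight (bigD1 r0) //= [in RHS](bigD1 r0) //= updE fE addnAC.
by congr (_ + _ + _)%N; apply: eq_bigr => s /updN ->.
Qed.
End Split.

Section Nodes.
Variables (F : fieldType) (th : F -> F) (q a : F) (n : nat) (x : 'I_n -> F).
Hypothesis q0 : q != 0.
Hypothesis a0 : a != 0.
Hypothesis x0 : forall r, x r != 0.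
Hypothesis th1 : th 1 = 0.
Hypothesis thV : forall y : F, y != 0 -> th y^-1 = - (th y / y).
Hypothesis hA : forall r s k, th (a * x r * x s * q ^+ k) != 0.
Hypothesis hX : forall r s k l, r != s -> th (x r / x s * q ^+ k / q ^+ l) != 0.
Hypothesis hq : forall k, th (q * q ^+ k) != 0.
Notation efact := (efact th q).
Notation pair_factor := (pair_factor th q a).
Notation ordered_factor := (ordered_factor th q a).
Notation param_factor := (param_factor th q a).
Notation site_factor := (site_factor th q a).
Implicit Types (b c d e : F) (r s : 'I_n) (N j : 'I_n -> nat).

(** The parameter b enters through b / a and through B = b q^|N|. At the nodes
    b changes to b q^D and |N| to |N| - D, so that B stays the same. For e =
    a^2 q / (b c d) this is the summand of the Bailey sum up to factors
    independent of j. *)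
Definition summand N b c d e j :=
  (b / a) ^+ weight j *
  (\prod_r (site_factor (b * q ^+ weight N) d e (x r) (N r) (j r) * param_factor c (x r) (N r) (j r))) *
  (\prod_(r < n) \prod_(s < n | (r < s)%N) pair_factor (x r) (x s) (j r) (j s)) *
  (\prod_(r < n) \prod_(s < n) ordered_factor (x r) (x s) (N r) (N s) (j r) (j s)).

Definition off_site r0 N j :=
  (\prod_(r < n | r != r0) \prod_(s < n | (s != r0) && (r < s)%N) pair_factor (x r) (x s) (j r) (j s)) *
  \prod_(r < n | r != r0) \prod_(s | s != r0) ordered_factor (x r) (x s) (N r) (N s) (j r) (j s).

(** All dependence on the index r0 is collected in front of [off_site], which
    is what a change of N r0 leaves untouched. *)
Lemma summand_split r0 N b c d e j :
  let B := b * q ^+ weight N in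
  summand N b c d e j =
  ((b / a) ^+ j r0 * (param_factor c (x r0) (N r0) (j r0) *
      ordered_factor (x r0) (x r0) (N r0) (N r0) (j r0) (j r0) * site_factor B d e (x r0) (N r0) (j r0))) *
  \prod_(s | s != r0) ((b / a) ^+ j s * site_factor B d e (x s) (N s) (j s) *
     (param_factor c (x s) (N s) (j s) * pair_factor (x r0) (x s) (j r0) (j s) *
      ordered_factor (x r0) (x s) (N r0) (N s) (j r0) (j s) *
      ordered_factor (x s) (x r0) (N s) (N r0) (j s) (j r0))) * off_site r0 N j.
Proof.
move=> B; rewrite /summand /off_site (prod_pairs_split r0); last by move=> r s; apply: pair_factorC.
rewrite (prod_all_split r0) /weight -prodrXr (bigD1 r0) //= (bigD1 r0 (P := xpredT)) //= -/B.
rewrite !big_split /=; ring.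
Qed.

Lemma off_site_upd r0 N i j k : off_site r0 (upd N r0 i) (upd j r0 k) = off_site r0 N j.
Proof.
rewrite /off_site; congr (_ * _); apply: eq_bigr => r rr0; apply: eq_bigr.
  by move=> s /andP[sr0 _]; rewrite !updN.
by move=> s sr0; rewrite !updN.
Qed.

Lemma generic_pair_x r s : r != s -> generic_pair th q a (x r) (x s).
Proof. by move=> rs; split=> // k l; apply: hX. Qed.

Definition trunc_site_ratio r0 B d e i D := (efact (q ^+ i.+1) D)^-1 *
  (efact (B / q ^+ (i + D) / (a * x r0)) D * efact (a * q ^+ i.+1 * x r0 / d) D *
   efact (a * q ^+ i.+1 * x r0 / e) D).

(** The factor by which the pairs containing r0 change, common to both kinds
    of nodes. *)
Definition cross_ratio r0 N i D := \prod_(s | s != r0)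
  (efact (x r0 / x s * q ^+ i.+1) D * efact (a * x s * x r0 * q ^+ (i.+1 + N s)) D)^-1.

Lemma upd_id N r0 : upd N r0 (N r0) = N.
Proof. by apply: boolp.funext => r; rewrite /upd; case: eqP => [->|]. Qed.

(** First kind of node: up to a factor independent of j, the summand is that
    for N r0 lowered to i, with b q^D and c / q^D in place of b and c. *)
Lemma summand_trunc r0 N b d e j i D :
  d != 0 -> e != 0 -> N r0 = (i + D)%N -> (forall r, (j r <= N r)%N) -> (j r0 <= i)%N ->
  summand N b (x r0 * q ^+ i)^-1 d e j =
  trunc_site_ratio r0 (b * q ^+ weight N) d e i D * cross_ratio r0 N i D *
  summand (upd N r0 i) (b * q ^+ D) (x r0 * q ^+ (i + D))^-1 d e j.
Proof.
move=> d0 e0 Nr0 jN ji; rewrite !(summand_split r0).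
have -> : b * q ^+ D * q ^+ weight (upd N r0 i) = b * q ^+ weight N.
  by rewrite (weight_upd Nr0) exprD; ring.
set B := b * q ^+ weight N.
have -> : off_site r0 (upd N r0 i) j = off_site r0 N j.
  by rewrite -[j in LHS](upd_id j r0) off_site_upd.
rewrite [RHS]mulrA; congr (_ * _).
have bq k : (b / a) ^+ k = (b * q ^+ D / a) ^+ k / q ^+ (D * k).
  rewrite !exprMn -exprM; field.
  by rewrite qexp_neq0.
rewrite [RHS]mulrACA; congr (_ * _).
  rewrite !updE Nr0 bq.
  have := trunc_site q0 a0 thV B D (x0 r0) d0 e0 hq (hA r0 r0) ji.
  rewrite /trunc_site_ratio; move: (param_factor _ _ _ _ * _ * _) => u; move: (param_factor _ _ _ _ * _ * _) => v E.
  transitivity ((b * q ^+ D / a) ^+ j r0 * (u / q ^+ (D * j r0))); first by ring.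
  by rewrite E; ring.
rewrite /cross_ratio -big_split /=; apply: eq_bigr => s sr0.
rewrite !(updN _ _ sr0) !updE Nr0 bq.
have rs : r0 != s by rewrite eq_sym.
have := trunc_cross q0 thV D (generic_pair_x rs) (generic_pair_x sr0) ji (jN s).
set k := (efact _ D * efact _ D)^-1.
set P1 := param_factor _ _ _ _; set P2 := ordered_factor _ _ _ _ _ _; set P3 := ordered_factor _ _ _ _ _ _.
set Q1 := param_factor _ _ _ _; set Q2 := ordered_factor _ _ _ _ _ _; set Q3 := ordered_factor _ _ _ _ _ _ => E.
set S := pair_factor _ _ _ _; set U := site_factor _ _ _ _ _ _; set bb := (_ / a) ^+ _.
transitivity (bb * U * S * (P1 * P2 * P3 / q ^+ (D * j s))); first by ring.
by rewrite E; ring.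
Qed.

(** Second kind of node: the index j r0 = N r0 is frozen, and removing it
    amounts to lowering N r0 to 0, again with b q^D and c / q^D in place of b
    and c. *)
Lemma summand_sat r0 N b d e j D :
  d != 0 -> e != 0 -> N r0 = D -> (forall r, (j r <= N r)%N) -> j r0 = D ->
  summand N b (a * q ^+ D * x r0) d e j =
  (b / a) ^+ D * (x r0 ^- D * (efact q D)^-1 * (efact (b * q ^+ weight N * x r0) D *
       efact (d * x r0) D * efact (e * x r0) D)) * cross_ratio r0 N 0 D *
  summand (upd N r0 0) (b * q ^+ D) (a * x r0) d e (upd j r0 0).
Proof.
move=> d0 e0 Nr0 jN jD; rewrite !(summand_split r0).
have -> : b * q ^+ D * q ^+ weight (upd N r0 0) = b * q ^+ weight N.
  by rewrite (@weight_upd _ N r0 0 D) // exprD; ring.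
set B := b * q ^+ weight N.
rewrite off_site_upd [RHS]mulrA; congr (_ * _).
have bq k : (b / a) ^+ k = (b * q ^+ D / a) ^+ k / q ^+ (D * k).
  rewrite !exprMn -exprM; field.
  by rewrite qexp_neq0.
rewrite [RHS]mulrACA; congr (_ * _).
  rewrite !updE Nr0 jD (sat_site q0 B D (x0 r0) d0 e0 hq (hA r0 r0)).
  by rewrite expr0; ring.
rewrite /cross_ratio -big_split /=; apply: eq_bigr => s sr0.
rewrite !(updN _ _ sr0) !updE Nr0 jD bq.
have rs : r0 != s by rewrite eq_sym.
have := sat_cross q0 a0 D (generic_pair_x rs) (generic_pair_x sr0) (jN s).
have -> : q * x r0 / x s = x r0 / x s * q ^+ 1 by ring.
rewrite -add1n.
set k := (efact _ D * efact _ D)^-1.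
set P1 := param_factor _ _ _ _; set P2 := pair_factor _ _ _ _; set P3 := ordered_factor _ _ _ _ _ _; set P4 := ordered_factor _ _ _ _ _ _.
set Q1 := param_factor _ _ _ _; set Q2 := pair_factor _ _ _ _; set Q3 := ordered_factor _ _ _ _ _ _; set Q4 := ordered_factor _ _ _ _ _ _ => E.
set U := site_factor _ _ _ _ _ _; set bb := (_ / a) ^+ _.
transitivity (bb * U * (P1 * P2 * P3 * P4 / q ^+ (D * j s))); first by ring.
by rewrite E; ring.
Qed.

Lemma efact_eq0 y k i : (i < k)%N -> y * q ^+ i = 1 -> efact y k = 0.
Proof.
by move=> ik yi; rewrite /efact (bigD1 (Ordinal ik)) //= yi th1 mul0r.
Qed.

Lemma summand_zero r0 N b c d e j : param_factor c (x r0) (N r0) (j r0) = 0 -> summand N b c d e j = 0.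
Proof. by move=> p0; rewrite (summand_split r0) p0 !(mulr0, mul0r). Qed.

Lemma summand_trunc0 r0 N b d e j i : (i < j r0)%N ->
  summand N b (x r0 * q ^+ i)^-1 d e j = 0.
Proof.
move=> ij; apply: (@summand_zero r0); rewrite /param_factor (efact_eq0 ij) ?mul0r //.
by field; rewrite ?oner_eq0 ?x0 qexp_neq0.
Qed.

Lemma summand_sat0 r0 N b d e j D : N r0 = D -> (j r0 < D)%N ->
  summand N b (a * q ^+ D * x r0) d e j = 0.
Proof.
move=> Nr0 jD; apply: (@summand_zero r0); rewrite /param_factor.
have lt : (D - (j r0).+1 < D - j r0)%N by lia.
rewrite Nr0 (efact_eq0 lt) ?mulr0 //.
have -> : a * q ^+ (j r0).+1 * x r0 / (a * q ^+ D * x r0) * q ^+ (D - (j r0).+1) =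
   q ^+ ((j r0).+1 + (D - (j r0).+1)) / q ^+ D.
  by rewrite exprD; field; rewrite ?a0 ?x0 ?qexp_neq0.
by rewrite subnKC // divff ?qexp_neq0.
Qed.

Definition box_norm N := (\prod_(r < n) \prod_(s < n) efact (q * x r / x s) (N r) *
   \prod_(r < n) \prod_(s < n | (r < s)%N) efact (a * x r * x s * q) (N r + N s))^-1.

Definition box_value N c d e := box_norm N *
  (efact (a * q / (d * e)) (weight N) * efact (a * q / (c * e)) (weight N) * efact (a * q / (c * d)) (weight N)).

Lemma box_norm_upd r0 N i D : N r0 = (i + D)%N ->
  box_norm N = (efact (q ^+ i.+1) D)^-1 * cross_ratio r0 N i D * box_norm (upd N r0 i).
Proof.
move=> Nr0; rewrite /box_norm !(prod_all_split r0 (fun r s => efact (q * x r / x s) _)).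
rewrite !(prod_pairs_split r0 (g := fun r s => efact (a * x r * x s * q) _));
  try by move=> r s; rewrite [a * x s * x r]mulrAC addnC.
rewrite /cross_ratio prodfV -!invfM !updE Nr0; congr (_^-1).
set R1 := \prod_(r | _) \prod_(s | s != r0) _; set R2 := \prod_(r | _) \prod_(s | _ && _) _.
set R1' := \prod_(r | _) \prod_(s | s != r0) _; set R2' := \prod_(r | _) \prod_(s | _ && _) _.
have -> : R1' = R1.
  by apply: eq_bigr => r rr0; apply: eq_bigr => s sr0; rewrite !updN.
have -> : R2' = R2.
  by apply: eq_bigr => r rr0; apply: eq_bigr => s /andP[sr0 _]; rewrite !updN.
have -> : q * x r0 / x r0 = q by rewrite mulfK.
rewrite efactD -exprS.
have -> : \prod_(s < n | s != r0) (efact (q * x r0 / x s) (i + D) * efact (q * x s / x r0) (N s)) =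
    \prod_(s < n | s != r0) (efact (q * x r0 / x s) i * efact (q * x s / x r0) (upd N r0 i s) *
      efact (x r0 / x s * q ^+ i.+1) D).
  apply: eq_bigr => s sr0; rewrite efactD updN // exprS.
  have -> : q * x r0 / x s * q ^+ i = x r0 / x s * (q * q ^+ i) by ring.
  by ring.
have -> : \prod_(s < n | s != r0) efact (a * x r0 * x s * q) (i + D + N s) =
    \prod_(s < n | s != r0) (efact (a * x r0 * x s * q) (i + upd N r0 i s) *
      efact (a * x s * x r0 * q ^+ (i.+1 + N s)) D).
  apply: eq_bigr => s sr0; rewrite updN // addnAC efactD; congr (_ * efact _ _).
  by rewrite addSn exprS; ring.
rewrite !big_split /=; ring.
Qed.

Lemma box_value_trunc r0 N b d e i D :
  b != 0 -> d != 0 -> e != 0 -> N r0 = (i + D)%N ->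
  b * (x r0 * q ^+ i)^-1 * d * e = a ^+ 2 * q ->
  box_value N (x r0 * q ^+ i)^-1 d e =
  trunc_site_ratio r0 (b * q ^+ weight N) d e i D * cross_ratio r0 N i D *
  box_value (upd N r0 i) (x r0 * q ^+ (i + D))^-1 d e.
Proof.
move=> b0 d0 e0 Nr0 bal; rewrite /box_value (box_norm_upd Nr0) /trunc_site_ratio (weight_upd Nr0).
set W := weight _.
have qn := qexp_neq0 q0.
have e1 u : u != 0 -> a * q / ((x r0 * q ^+ i)^-1 * u) = a * q ^+ i.+1 * x r0 / u.
  by move=> u0; rewrite exprS; field; rewrite ?oner_eq0 ?x0 ?qn ?u0.
have e2 u : u != 0 -> a * q / ((x r0 * q ^+ (i + D))^-1 * u) = a * q ^+ i.+1 * x r0 / u * q ^+ D.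
  by move=> u0; rewrite exprS exprD; field; rewrite ?oner_eq0 ?x0 ?qn ?u0.
have bE : b = a ^+ 2 * q * x r0 * q ^+ i / (d * e).
  apply: (@mulIf _ ((x r0 * q ^+ i)^-1 * d * e)); first by rewrite !mulf_neq0 ?invr_neq0 ?mulf_neq0.
  rewrite !mulrA bal; field; by rewrite ?oner_eq0 ?x0 ?qn ?d0 ?e0.
have e3 : b * q ^+ (W + D) / q ^+ (i + D) / (a * x r0) = a * q / (d * e) * q ^+ W.
  by rewrite bE !exprD; field; rewrite ?oner_eq0 ?x0 ?qn ?d0 ?e0 ?a0.
rewrite !e1 // !e2 // e3 efactD [(W + D)%N]addnC !(efactD _ _ _ D W).
ring.
Qed.

(** Reversal of the order of the factors, followed by theta(1/y) =
    -theta(y)/y. *)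
Lemma efact_flip y D : y != 0 ->
  efact (q / (q ^+ D * y)) D = efact y D * \prod_(l < D) - (y * q ^+ l)^-1.
Proof.
move=> y0; rewrite /efact (reindex_inj rev_ord_inj) -big_split /=; apply: eq_bigr => l _ /=.
have -> : q / (q ^+ D * y) * q ^+ (D - l.+1) = (y * q ^+ l)^-1.
  have -> : q ^+ D = q ^+ (D - l.+1) * q ^+ l * q.
    by rewrite -mulrA -exprSr -exprD subnK // ltn_ord.
  by field; rewrite ?oner_eq0 ?y0 ?(qexp_neq0 q0) ?q0.
by rewrite thV ?mulf_neq0 ?(qexp_neq0 q0) // mulrN.
Qed.

(** The sum of the first D odd numbers is D^2. *)
Lemma prod_flip_factors y z D : y != 0 -> z != 0 ->
  (\prod_(l < D) - (y * q ^+ l)^-1) * (\prod_(l < D) - (z * q ^+ l)^-1) =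
  (q / (q ^+ D * y * z)) ^+ D.
Proof.
move=> y0 z0; rewrite -big_split /=.
have qn := qexp_neq0 q0.
have -> : (q / (q ^+ D * y * z)) ^+ D = q ^+ D / (q ^+ (D * D) * y ^+ D * z ^+ D).
  by rewrite expr_div_n !exprMn -exprM.
elim: D => [|D IHD]; first by rewrite big_ord0 !expr0 !mul1r invr1.
rewrite big_ord_recr /= IHD.
have -> : q ^+ (D.+1 * D.+1) = q ^+ (D * D) * q ^+ D * q ^+ D * q.
  by rewrite -!exprD -exprSr; congr (_ ^+ _); lia.
rewrite !exprS; field.
by rewrite ?y0 ?z0 ?q0 ?qn ?(expf_neq0 _ y0) ?(expf_neq0 _ z0) ?oppr_eq0 ?oner_eq0.
Qed.

Lemma box_value_sat r0 N b d e D :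
  b != 0 -> d != 0 -> e != 0 -> N r0 = D ->
  b * (a * q ^+ D * x r0) * d * e = a ^+ 2 * q ->
  box_value N (a * q ^+ D * x r0) d e =
  (b / a) ^+ D * (x r0 ^- D * (efact q D)^-1 * (efact (b * q ^+ weight N * x r0) D *
       efact (d * x r0) D * efact (e * x r0) D)) * cross_ratio r0 N 0 D *
  box_value (upd N r0 0) (a * x r0) d e.
Proof.
move=> b0 d0 e0 Nr0 bal.
have Nr0' : N r0 = (0 + D)%N by [].
rewrite /box_value (box_norm_upd Nr0') (weight_upd Nr0'); set W := weight _.
have qn := qexp_neq0 q0.
have dx : d * x r0 != 0 by rewrite mulf_neq0.
have ex : e * x r0 != 0 by rewrite mulf_neq0.
have e1 u : u != 0 -> a * q / (a * q ^+ D * x r0 * u) = q / (q ^+ D * (u * x r0)).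
  by move=> u0; field; rewrite ?oner_eq0 ?x0 ?qn ?u0.
have e2 u : u != 0 -> a * q / (a * x r0 * u) = q / (q ^+ D * (u * x r0)) * q ^+ D.
  by move=> u0; field; rewrite ?oner_eq0 ?x0 ?qn ?u0.
have bE : b = a * q / (q ^+ D * x r0 * d * e).
  apply: (@mulIf _ (a * q ^+ D * x r0 * d * e)); first by rewrite !mulf_neq0.
  by rewrite !mulrA in bal *; rewrite bal; field; rewrite ?oner_eq0 ?x0 ?qn ?d0 ?e0.
have e3 : b * q ^+ (W + D) * x r0 = a * q / (d * e) * q ^+ W.
  by rewrite bE !exprD; field; rewrite ?oner_eq0 ?x0 ?qn ?d0 ?e0 ?a0.
have e4 : (b / a) ^+ D * x r0 ^- D = (q / (q ^+ D * (d * x r0) * (e * x r0))) ^+ D.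
  rewrite -exprVn -exprMn; congr (_ ^+ _).
  by rewrite bE; field; rewrite ?oner_eq0 ?x0 ?qn ?d0 ?e0 ?a0.
rewrite !mulrA e4 -(prod_flip_factors _ dx ex) expr1 !e1 // !e2 // e3 efactD [(W + D)%N]addnC !(efactD _ _ _ D W).
rewrite !efact_flip //.
ring.
Qed.
End Nodes.

(** * The summation formula *)

Lemma eventually_fin (I : finType) (P : I -> nat -> Prop) :
  (forall i, exists M, forall m, (M <= m)%N -> P i m) ->
  exists M, forall m, (M <= m)%N -> forall i, P i m.
Proof.
move=> /boolp.choice[f fP]; exists (\max_i f i) => m mM i.
by apply: fP; apply: leq_trans mM; apply: leq_bigmax.
Qed.

Section Interp2.
Variables (F : fieldType) (th : F -> F) (A0 A1 g0 g1 : F -> F).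
Hypothesis th1 : th 1 = 0.
Hypothesis thV : forall y : F, y != 0 -> th y^-1 = - (th y / y).
Hypothesis rank2 : forall u y : F, u != 0 -> y != 0 ->
  th (u * y) * th (u / y) = A0 u * g0 y + A1 u * g1 y.

Lemma thV_neq0 y : y != 0 -> th y != 0 -> th y^-1 != 0.
Proof. by move=> y0 ty; rewrite thV // oppr_eq0 mulf_neq0 ?invr_neq0. Qed.

(** If (g0 y, g1 y) and (g0 z, g1 z) were proportional, then theta(u y)
    theta(u / y) would be a multiple of theta(u z) theta(u / z) for all u,
    which fails at u = y or u = z because theta 1 = 0. *)
Lemma det_neq0 y z : y != 0 -> z != 0 -> th (y * z) != 0 -> th (y / z) != 0 ->
  g0 y * g1 z - g1 y * g0 z != 0.
Proof.
move=> y0 z0 tyz tydz; apply/eqP => /subr0_eq det.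
have fyz : A0 y * g0 z + A1 y * g1 z != 0 by rewrite -rank2 // mulf_neq0.
have fzy : A0 z * g0 y + A1 z * g1 y != 0.
  by rewrite -rank2 // mulf_neq0 // ?[z * y]mulrC // -invf_div thV_neq0 ?mulf_neq0 ?invr_neq0.
have fzz : A0 z * g0 z + A1 z * g1 z = 0 by rewrite -rank2 // divff // th1 mulr0.
have gz0 : g0 z = 0.
  apply/eqP; have : g0 z * (A0 z * g0 y + A1 z * g1 y) = g0 y * (A0 z * g0 z + A1 z * g1 z).
    transitivity (A0 z * g0 z * g0 y + A1 z * (g1 y * g0 z)); first by ring.
    by rewrite -det; ring.
  by rewrite fzz mulr0 => /eqP; rewrite mulf_eq0 (negPf fzy) orbF.
have gz1 : g1 z = 0.
  apply/eqP; have : g1 z * (A0 z * g0 y + A1 z * g1 y) = g1 y * (A0 z * g0 z + A1 z * g1 z).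
    transitivity (A0 z * (g0 y * g1 z) + A1 z * g1 z * g1 y); first by ring.
    by rewrite det; ring.
  by rewrite fzz mulr0 => /eqP; rewrite mulf_eq0 (negPf fzy) orbF.
by move: fyz; rewrite gz0 gz1 !mulr0 addr0 eqxx.
Qed.

(** The variable is c with c d = sg^2; it is the symmetric variable y = c / sg
    in which the function is a form. *)
Lemma interpolation d (E : F -> F -> F) sg (I : finType) (t : I -> F) :
  sg != 0 -> homog g0 g1 d (fun y => E (sg * y) (sg / y)) -> (d < #|I|)%N ->
  (forall i, t i != 0) -> (forall i, E (t i) (sg ^+ 2 / t i) = 0) ->
  (forall i j, i != j -> th (t i * t j / sg ^+ 2) != 0 /\ th (t i / t j) != 0) ->
  forall c, c != 0 -> E c (sg ^+ 2 / c) = 0.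
Proof.
move=> s0 hE dI t0 Et tt c c0.
have conv u : u != 0 -> E u (sg ^+ 2 / u) = E (sg * (u / sg)) (sg / (u / sg)).
  move=> u0; congr E; first by rewrite mulrC divfK.
  by field; rewrite s0 u0.
rewrite conv //; apply: (homog_zero hE dI (t := fun i => t i / sg)).
- by move=> i; rewrite mulf_neq0 ?invr_neq0.
- by move=> i; rewrite -conv.
- move=> i j ij; have [h1 h2] := tt _ _ ij.
  apply: det_neq0; rewrite ?mulf_neq0 ?invr_neq0 //.
    by rewrite mulrACA -invfM -expr2.
  by rewrite invf_div mulrA divfK.
- by rewrite mulf_neq0 ?invr_neq0.
Qed.
End Interp2.

Section Identity.
Variables (F : fieldType) (th : F -> F) (q a : F) (n : nat) (x : 'I_n -> F).
Variables (A0 A1 g0 g1 : F -> F) (M : nat).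
Hypothesis q0 : q != 0.
Hypothesis a0 : a != 0.
Hypothesis x0 : forall r, x r != 0.
Hypothesis th1 : th 1 = 0.
Hypothesis thV : forall y : F, y != 0 -> th y^-1 = - (th y / y).
Hypothesis rank2 : forall u y : F, u != 0 -> y != 0 ->
  th (u * y) * th (u / y) = A0 u * g0 y + A1 u * g1 y.
Hypothesis sqrtF : forall t : F, exists s, s ^+ 2 = t.
Hypothesis hgen : forall u : F, u != 0 -> exists M0, forall m, (M0 <= m)%N -> th (u * q ^+ m) != 0.
Hypothesis hA : forall r s k, th (a * x r * x s * q ^+ k) != 0.
Hypothesis hX : forall r s k l, r != s -> th (x r / x s * q ^+ k / q ^+ l) != 0.
Hypothesis hq : forall k, th (q * q ^+ k) != 0.
Notation efact := (efact th q).
Notation param_factor := (param_factor th q a).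
Notation site_factor := (site_factor th q a).
Notation summand := (summand th q a x).
Notation box_value := (box_value th q a x).
Implicit Types (b c d e : F) (r s : 'I_n) (N : 'I_n -> nat).
Implicit Types (j : {ffun 'I_n -> 'I_M.+1}).

(** The multi-indices of all boxes below M live in one finite type, so that
    sums over different boxes can be compared. *)
Definition natf j : 'I_n -> nat := fun r => j r.
Definition below N j := [forall r, (natf j r <= N r)%N].

Definition box_sum N b c d e := \sum_(j | below N j) summand N b c d e (natf j).

Lemma box_sum_trunc r0 N b d e i D :
  d != 0 -> e != 0 -> N r0 = (i + D)%N ->
  box_sum N b (x r0 * q ^+ i)^-1 d e =
  trunc_site_ratio th q a x r0 (b * q ^+ weight N) d e i D * cross_ratio th q a x r0 N i D *
  box_sum (upd N r0 i) (b * q ^+ D) (x r0 * q ^+ (i + D))^-1 d e.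
Proof.
move=> d0 e0 Nr0; rewrite /box_sum mulr_sumr big_mkcond [RHS]big_mkcond /=.
apply: eq_bigr => j _; case: ifP => [/forallP jN|jN].
  case: ifP => [/forallP jN'|/negbT].
    apply: summand_trunc => //; by have := jN' r0; rewrite updE.
  rewrite negb_forall => /existsP[r]; rewrite -ltnNge => ltj.
  have [rr0|rr0] := eqVneq r r0; last by move: ltj; rewrite updN // ltnNge jN.
  by rewrite rr0 updE in ltj; apply: (summand_trunc0 a q0 x0 th1) ltj.
case: ifP => // /forallP jN'; case/forallP: jN => r.
have := jN' r; have [->|rr0] := eqVneq r r0; last by rewrite updN.
by rewrite updE Nr0 => /leq_trans -> //; rewrite leq_addr.
Qed.

Lemma box_sum_sat r0 N b d e D :
  d != 0 -> e != 0 -> N r0 = D -> (D <= M)%N ->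
  box_sum N b (a * q ^+ D * x r0) d e =
  (b / a) ^+ D * (x r0 ^- D * (efact q D)^-1 * (efact (b * q ^+ weight N * x r0) D *
       efact (d * x r0) D * efact (e * x r0) D)) * cross_ratio th q a x r0 N 0 D *
  box_sum (upd N r0 0) (b * q ^+ D) (a * x r0) d e.
Proof.
move=> d0 e0 Nr0 DM; rewrite /box_sum mulr_sumr.
rewrite (bigID (fun j => natf j r0 == D)) /= addrC big1 ?add0r; last first.
  move=> j /andP[/forallP jN jr0]; apply: (summand_sat0 q0 a0 x0 th1 _ _ _ Nr0).
  by rewrite ltn_neqAle jr0 -Nr0 jN.
pose h (v : 'I_M.+1) j : {ffun 'I_n -> 'I_M.+1} := [ffun r => if r == r0 then v else j r].
rewrite (reindex_onto (h (inord D)) (h ord0)) /=; last first.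
  move=> j /andP[_ /eqP jr0]; apply/ffunP => r; rewrite !ffunE.
  by case: eqP => // ->; apply: val_inj; rewrite /= inordK // -jr0.
have nfh v j : natf (h v j) = upd (natf j) r0 v.
  by apply: boolp.funext => r; rewrite /natf /upd ffunE; case: eqP.
have nfD j : natf (h (inord D) j) r0 = D by rewrite nfh updE inordK.
apply: eq_big => [j|j /andP[/andP[/forallP jN _] /eqP jE]].
  rewrite nfD eqxx andbT; apply/andP/forallP => [[/forallP jN /eqP jE] r|jN].
    have [->|rr0] := eqVneq r r0; first by rewrite updE -jE nfh updE.
    by have := jN r; rewrite nfh !updN.
  split.
    apply/forallP => r; have := jN r; rewrite nfh.
    by have [->|rr0] := eqVneq r r0; rewrite ?updE ?inordK ?Nr0 // !updN.
  apply/eqP/ffunP => r; rewrite !ffunE; case: eqP => // ->.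
  by apply: val_inj => /=; have := jN r0; rewrite updE leqn0 => /eqP.
rewrite (summand_sat q0 a0 x0 hA hX hq) //.
congr (_ * summand _ _ _ _ _ _); rewrite -[in RHS]jE !nfh.
by apply: boolp.funext => r; rewrite /upd; case: eqP.
Qed.

Definition box_formula N := forall b c d e, b != 0 -> c != 0 -> d != 0 -> e != 0 ->
  b * c * d * e = a ^+ 2 * q -> box_sum N b c d e = box_value N c d e.

Lemma box_formula_trunc r0 N b d e i : (i <= N r0)%N -> box_formula (upd N r0 i) ->
  b != 0 -> d != 0 -> e != 0 -> b * (x r0 * q ^+ i)^-1 * d * e = a ^+ 2 * q ->
  box_sum N b (x r0 * q ^+ i)^-1 d e = box_value N (x r0 * q ^+ i)^-1 d e.
Proof.
move=> iN IH b0 d0 e0 bal; have Nr0 : N r0 = (i + (N r0 - i))%N by rewrite subnKC.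
rewrite (box_sum_trunc _ d0 e0 Nr0) IH ?(box_value_trunc th q0 a0 x0 b0 d0 e0 Nr0) //.
- by rewrite mulf_neq0 ?qexp_neq0.
- by rewrite invr_neq0 // mulf_neq0 ?qexp_neq0.
- rewrite -bal exprD; field.
  by rewrite x0 !qexp_neq0.
Qed.

Lemma box_formula_sat r0 N b d e : (N r0 <= M)%N -> box_formula (upd N r0 0) ->
  b != 0 -> d != 0 -> e != 0 -> b * (a * q ^+ N r0 * x r0) * d * e = a ^+ 2 * q ->
  box_sum N b (a * q ^+ N r0 * x r0) d e = box_value N (a * q ^+ N r0 * x r0) d e.
Proof.
move=> NM IH b0 d0 e0 bal.
rewrite (box_sum_sat _ d0 e0 _ NM) // IH ?(box_value_sat q0 a0 x0 thV b0 d0 e0 _ bal) //.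
- by rewrite mulf_neq0 ?qexp_neq0.
- by rewrite mulf_neq0.
- rewrite -bal; ring.
Qed.

Lemma box_formula0 N : weight N = 0%N -> box_formula N.
Proof.
move=> N0 b c d e b0 c0 d0 e0 bal.
have NE r : N r = 0%N by apply/eqP; move: N0 => /eqP; rewrite sum_nat_eq0 => /forallP/(_ r).
rewrite /box_sum (big_pred1 [ffun=> ord0]) => [|j]; last first.
  apply/forallP/eqP => [jN|-> r]; last by rewrite /natf ffunE.
  apply/ffunP => r; rewrite ffunE; apply: val_inj; apply/eqP.
  by rewrite -leqn0 -(NE r); apply: jN.
have -> : natf [ffun=> ord0] = N by apply: boolp.funext => r; rewrite /natf ffunE NE.
rewrite /box_value /summand /box_norm N0 !efact0 !mulr1 expr0 mul1r.
rewrite big1 => [|r _]; last first.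
  rewrite /site_factor /param_factor !NE !subnn !efact0 !(mulr1, expr0) divff ?invr1 ?mulr1 //.
  by have := hA r r 0; rewrite mulr1 expr2 mulrA.
rewrite big1 => [|r _]; last first.
  rewrite big1 // => s _; rewrite /pair_factor !NE addn0 muln0 !expr0 !mulr1 divff //.
  by have := hA r s 0; rewrite mulr1.
rewrite big1 => [|r _]; last first.
  by rewrite big1 // => s _; rewrite /ordered_factor !NE subnn addn0 !efact0 !mulr1 invr1 ?mulr1.
rewrite big1 => [|r _]; last by rewrite big1 // => s _; rewrite ?NE ?addn0 efact0.
rewrite big1 => [|r _]; last by rewrite big1 // => s _; rewrite ?NE ?addn0 efact0.
by rewrite !mul1r invr1.
Qed.

Lemma box_sumC N b c d e : box_sum N b c d e = box_sum N b c e d.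
Proof.
apply: eq_bigr => j _; rewrite /summand; congr (_ * _ * _ * _).
by apply: eq_bigr => r _; rewrite /site_factor [param_factor d _ _ _ * _]mulrC.
Qed.

Lemma box_valueC N c d e : box_value N c d e = box_value N c e d.
Proof. by rewrite /box_value [d * e]mulrC; ring. Qed.

Notation linform := (linform g0 g1).
Notation linprod := (linprod g0 g1).
Notation homog := (homog g0 g1).

Lemma linform_th u : u != 0 -> linform (fun y => th (u * y) * th (u / y)).
Proof. by move=> u0; exists (A0 u), (A1 u) => y y0; apply: rank2. Qed.

Lemma linprod_pfac (sg X : F) K k : sg != 0 -> X != 0 -> (k <= K)%N ->
  linprod K (fun y => param_factor (sg * y) X K k * param_factor (sg / y) X K k).
Proof.
move=> s0 X0 kK; rewrite -{1}(subnKC kK).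
have h1 := @linprod_ord _ g0 g1 k
  (fun i y => th (sg * X * q ^+ i * y) * th (sg * X * q ^+ i / y)).
have h2 := @linprod_ord _ g0 g1 (K - k)
  (fun i y => th (a * q ^+ k.+1 * X / sg * q ^+ i * y) * th (a * q ^+ k.+1 * X / sg * q ^+ i / y)).
apply: linprod_ext (linprodM (h1 _) (h2 _)).
- move=> y y0; rewrite /param_factor /efact !big_split /=.
  rewrite mulrACA [X in _ * X = _]mulrC; congr (_ * _ * (_ * _)).
  + by apply: eq_bigr => i _; congr th; ring.
  + by apply: eq_bigr => i _; congr th; ring.
  + by apply: eq_bigr => i _; congr th; field; rewrite ?s0 ?y0.
  + by apply: eq_bigr => i _; congr th; field; rewrite ?s0 ?y0.
- by move=> i; apply: linform_th; rewrite !mulf_neq0 ?qexp_neq0.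
- by move=> i; apply: linform_th; rewrite !mulf_neq0 ?qexp_neq0 ?invr_neq0.
Qed.

(** Both sides are forms of the same degree |N| in y. Of the three factorials
    on the right, the one in c d is constant, and the two others pair up. *)
Lemma homog_defect N b e sg : sg != 0 -> e != 0 ->
  homog (weight N) (fun y => box_sum N b (sg * y) (sg / y) e - box_value N (sg * y) (sg / y) e).
Proof.
move=> s0 e0; rewrite /box_sum.
pose w := a * q / (sg * e).
apply: (@homog_eq _ _ _ _ _ (fun y => \sum_(j | below N j) summand N b (sg * y) (sg / y) e (natf j) +
   - (box_norm th q a x N * efact (a * q / sg ^+ 2) (weight N)) *
   \prod_(i < weight N) (th (w * q ^+ i * y) * th (w * q ^+ i / y)))).
  move=> y y0; congr (_ + _); rewrite /box_value mulNr; congr (- _).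
  have -> : a * q / (sg * y * (sg / y)) = a * q / sg ^+ 2 by field; rewrite y0 s0.
  have -> : efact (a * q / (sg / y * e)) (weight N) = \prod_(i < weight N) th (w * q ^+ i * y).
    by apply: eq_bigr => i _; congr th; rewrite /w; field; rewrite y0 s0 e0.
  have -> : efact (a * q / (sg * y * e)) (weight N) = \prod_(i < weight N) th (w * q ^+ i / y).
    by apply: eq_bigr => i _; congr th; rewrite /w; field; rewrite y0 s0 e0.
  by rewrite big_split /=; ring.
have w0 : w != 0 by rewrite !mulf_neq0 ?invr_neq0 ?mulf_neq0.
apply: homog_add.
  apply: homog_sum => j /forallP jN.
  pose K := (b / a) ^+ weight (natf j) *
    (\prod_r (x r ^- natf j r * (th (a * x r ^+ 2 * q ^+ (2 * natf j r)) / th (a * x r ^+ 2)) *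
      (efact (b * q ^+ weight N / q ^+ N r / (a * x r)) (N r - natf j r) * efact (b * q ^+ weight N * x r) (natf j r)) *
      param_factor e (x r) (N r) (natf j r))) *
    (\prod_(r < n) \prod_(s < n | (r < s)%N) pair_factor th q a (x r) (x s) (natf j r) (natf j s)) *
    (\prod_(r < n) \prod_(s < n) ordered_factor th q a (x r) (x s) (N r) (N s) (natf j r) (natf j s)).
  apply: (@homog_eq _ _ _ _ _ (fun y => K * \prod_r
      (param_factor (sg * y) (x r) (N r) (natf j r) * param_factor (sg / y) (x r) (N r) (natf j r)))).
    move=> y y0; rewrite /summand /K; set S := (\prod_(r < n) \prod_(s < n | _) _).
    set O := (\prod_(r < n) \prod_(s < n) _).
    have -> : \prod_r (site_factor (b * q ^+ weight N) (sg / y) e (x r) (N r) (natf j r) *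
       param_factor (sg * y) (x r) (N r) (natf j r)) =
      (\prod_r (x r ^- natf j r * (th (a * x r ^+ 2 * q ^+ (2 * natf j r)) / th (a * x r ^+ 2)) *
      (efact (b * q ^+ weight N / q ^+ N r / (a * x r)) (N r - natf j r) * efact (b * q ^+ weight N * x r) (natf j r)) *
      param_factor e (x r) (N r) (natf j r))) * \prod_r
      (param_factor (sg * y) (x r) (N r) (natf j r) * param_factor (sg / y) (x r) (N r) (natf j r)).
      by rewrite -big_split /=; apply: eq_bigr => r _; rewrite /site_factor; ring.
    by ring.
  apply: homog_linprod; apply: linprod_prod => r; exact: linprod_pfac.
apply: homog_linprod.
apply: (@linprod_ord _ g0 g1 (weight N) (fun i y => th (w * q ^+ i * y) * th (w * q ^+ i / y))).
by move=> i; apply: linform_th; rewrite mulf_neq0 ?qexp_neq0.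
Qed.

(** The |N| nodes of the first kind, and one node of the second kind at a
    chosen index r1. *)
Definition node N r1 (i : option {r : 'I_n & 'I_(N r)}) : F :=
  if i is Some v then (x (tag v) * q ^+ tagged v)^-1 else a * q ^+ N r1 * x r1.

Lemma node_neq0 N r1 (i : option {r : 'I_n & 'I_(N r)}) : node r1 i != 0.
Proof.
by case: i => [v|] /=; rewrite ?invr_neq0 // !mulf_neq0 ?qexp_neq0.
Qed.

Lemma th_qdiv (i k : nat) : i != k -> th (q ^+ i / q ^+ k) != 0.
Proof.
have pos (m l : nat) : (m < l)%N -> th (q ^+ l / q ^+ m) != 0.
  move=> ml; have -> : q ^+ l / q ^+ m = q * q ^+ (l - m.+1) by rewrite -exprS -subSn // subSS expfB.
  exact: hq.
rewrite neq_ltn => /orP[] ik; last exact: pos.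
by rewrite -invf_div (thV_neq0 thV) ?pos // mulf_neq0 ?invr_neq0 ?qexp_neq0.
Qed.

Lemma node_distinct N r1 (i j : option {r : 'I_n & 'I_(N r)}) :
  i != j -> th (node r1 i / node r1 j) != 0.
Proof.
have key (v : {r : 'I_n & 'I_(N r)}) :
    th (a * q ^+ N r1 * x r1 / (x (tag v) * q ^+ tagged v)^-1) != 0.
  rewrite invrK; have := hA r1 (tag v) (N r1 + tagged v).
  by congr (th _ != 0); rewrite exprD; ring.
case: i j => [[r i]|] [[s j]|] //= ij.
- have [rs|rs] := eqVneq r s.
    move: j ij; rewrite -rs => j ij.
    have -> : (x r * q ^+ i)^-1 / (x r * q ^+ j)^-1 = q ^+ j / q ^+ i.
      by field; rewrite ?oner_eq0 ?x0 ?qexp_neq0.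
    apply: th_qdiv; apply: contra ij => /eqP/val_inj ->; exact: eqxx.
  have -> : (x r * q ^+ i)^-1 / (x s * q ^+ j)^-1 = x s / x r * q ^+ j / q ^+ i.
    by field; rewrite ?oner_eq0 ?x0 ?qexp_neq0.
  by apply: hX; rewrite eq_sym.
- have := key (Tagged (fun r => 'I_(N r)) i); rewrite /= -[in X in _ -> X]invf_div => k0.
  by apply: (thV_neq0 thV) k0; rewrite invrK !mulf_neq0 ?qexp_neq0.
- exact: (key (Tagged (fun r => 'I_(N r)) j)).
Qed.

Lemma card_node N : (weight N < #|{: option {r : 'I_n & 'I_(N r)}}|)%N.
Proof.
rewrite card_option card_tagged sumnE big_map big_enum /=.
by rewrite ltnS /weight leq_eqVlt; apply/orP; left; apply/eqP/eq_bigr => r _; rewrite card_ord.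
Qed.

Definition admissible N := forall r, (N r <= M)%N.

(** The interpolation argument for a product c d = tau that keeps the nodes
    distinct. *)
Lemma box_formula_generic N r1 (tau : F) : admissible N ->
  (0 < N r1)%N -> (forall N', admissible N' -> (weight N' < weight N)%N -> box_formula N') ->
  tau != 0 -> (forall u v, u != v -> th (node (N := N) r1 u * node r1 v / tau) != 0) ->
  forall b c e, b != 0 -> c != 0 -> e != 0 -> b * tau * e = a ^+ 2 * q ->
  box_sum N b c (tau / c) e = box_value N c (tau / c) e.
Proof.
move=> NM N1 IH t0 tgen b c e b0 c0 e0 bal; apply/eqP; rewrite -subr_eq0; apply/eqP.
have [sg sgE] := sqrtF tau.
have sg0 : sg != 0 by apply: contraNneq t0 => s0; rewrite -sgE s0 expr0n.
have updP r i : (i < N r)%N -> admissible (upd N r i) /\ (weight (upd N r i) < weight N)%N.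
  move=> iN; split.
    move=> s; rewrite /upd; case: eqP => // _; apply: leq_trans (NM r); exact: ltnW.
  have E : N r = (i + (N r - i))%N by rewrite subnKC // ltnW.
  by rewrite (weight_upd E) -[X in (X < _)%N]addn0 ltn_add2l subn_gt0.
rewrite -sgE.
apply: (interpolation th1 thV rank2 (E := fun c d => box_sum N b c d e - box_value N c d e)
  sg0 (homog_defect N b sg0 e0) (card_node N) (@node_neq0 N r1)) => //.
  move=> i; rewrite sgE.
  have bal' u : u != 0 -> b * u * (tau / u) * e = a ^+ 2 * q.
    by move=> u0; rewrite -bal; field.
  have n0 := node_neq0 r1 i; have d0 : tau / node r1 i != 0 by rewrite mulf_neq0 ?invr_neq0.
  have := bal' _ n0; move: n0 d0; case: i => [[r i]|] /= n0 d0 balr.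
    have [adm lt] := updP r i (ltn_ord i).
    rewrite box_formula_trunc ?subrr //; [exact: ltnW | exact: IH].
  have [adm lt] := updP r1 0%N N1.
  by rewrite box_formula_sat ?subrr //; exact: IH.
by move=> i j ij; rewrite sgE; split; [apply: tgen | apply: node_distinct].
Qed.

(** Induction on |N|; a second interpolation, with c e fixed, removes the
    condition on c d. *)
Lemma box_formula_all K N : (weight N <= K)%N -> admissible N -> box_formula N.
Proof.
elim: K N => [|K IHK] N wN NM.
  by apply: box_formula0; apply/eqP; rewrite -leqn0.
have [N0|N0] := eqVneq (weight N) 0%N; first exact: box_formula0.
have [r1 N1] : exists r1, (0 < N r1)%N.
  apply/existsP; apply: contraR N0; rewrite negb_exists => /forallP h.
  by rewrite /weight sum_nat_eq0; apply/forallP => r; have := h r; rewrite lt0n negbK.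
have IH N' : admissible N' -> (weight N' < weight N)%N -> box_formula N'.
  by move=> adm lt; apply: IHK => //; rewrite -ltnS (leq_trans lt).
move=> b c d e b0 c0 d0 e0 bal; apply/eqP; rewrite -subr_eq0; apply/eqP.
have [sg sgE] := sqrtF (c * e).
have ce0 : c * e != 0 by rewrite mulf_neq0.
have sg0 : sg != 0 by apply: contraNneq ce0 => s0; rewrite -sgE s0 expr0n.
pose I := option {r : 'I_n & 'I_(N r)}.
have [M1 M1P] : exists M1, forall m, (M1 <= m)%N -> forall ij : I * I,
    th (node r1 ij.1 * node r1 ij.2 / (q ^+ m * d)) != 0.
  apply: eventually_fin => -[v w] /=.
  have n0 : d / (node r1 v * node r1 w) != 0.
    by rewrite mulf_neq0 ?invr_neq0 ?mulf_neq0 ?node_neq0.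
  have [M0 M0P] := hgen n0; exists M0 => m /M0P nz.
  have -> : node r1 v * node r1 w / (q ^+ m * d) = (d / (node r1 v * node r1 w) * q ^+ m)^-1.
    by field; rewrite d0 !qexp_neq0 ?node_neq0.
  by rewrite (thV_neq0 thV) // mulf_neq0 ?qexp_neq0.
have [M2 M2P] := hgen (invr_neq0 ce0).
pose M0 := maxn M1 M2.
(* Above M1 the product c d = q^m d keeps the nodes apart, above M2 the points q^m are themselves distinct nodes for the product c e. *)
pose t (m : 'I_(weight N).+1) := q ^+ (M0 + m).
rewrite box_sumC box_valueC; have -> : e = sg ^+ 2 / c by rewrite sgE mulrC mulKf.
apply: (interpolation th1 thV rank2 (E := fun c e => box_sum N b c e d - box_value N c e d)
  sg0 (homog_defect N b sg0 d0) _ (t := t)) => //.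
- by rewrite card_ord.
- by move=> m; rewrite /t qexp_neq0.
- move=> m; rewrite /t sgE; set u := q ^+ _.
  have u0 : u != 0 by rewrite qexp_neq0.
  have ge1 : (M1 <= M0 + m)%N by rewrite (leq_trans (leq_maxl M1 M2)) ?leq_addr.
  rewrite box_sumC box_valueC.
  have gen := @box_formula_generic N r1 (u * d) NM N1 IH (mulf_neq0 u0 d0)
     (fun u v _ => M1P _ ge1 (u, v)) b u (c * e / u) b0 u0.
  have dE : u * d / u = d by rewrite mulrC mulKf.
  rewrite dE in gen; rewrite gen ?subrr ?mulf_neq0 ?invr_neq0 //.
  rewrite -bal; field; by [].
- move=> m m' mm'; rewrite sgE /t; split.
    rewrite -exprD mulrC; apply: M2P.
    by rewrite (leq_trans (leq_maxr M1 M2)) // -addnA leq_addr.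
  by apply: th_qdiv; rewrite eqn_add2l.
Qed.

End Identity.

(** * Clearing denominators in the Bailey pair *)

Section Link.
Variables (F : fieldType) (th : F -> F) (q a b c d : F) (n : nat) (x : 'I_n -> F).
Hypothesis q0 : q != 0.
Hypothesis a0 : a != 0.
Hypothesis b0 : b != 0.
Hypothesis c0 : c != 0.
Hypothesis d0 : d != 0.
Hypothesis x0 : forall r, x r != 0.
Variable N : 'I_n -> nat.
Notation efact := (efact th q).
Hypothesis hN : forall r, efact (a * x r * q / c) (N r) * (efact (a * x r * q / d) (N r) *
   (efact (b * c * d * x r / a) (N r) * 1)) != 0.
Let W := weight N.
Let e := a ^+ 2 * q / (b * c * d).

(** The factor, independent of j, by which the entries of the Bailey matrix
    times alpha differ from the summands of the summation formula. *)
Definition link_const := (\prod_(r < n) \prod_(s < n | (r < s)%N) efact (a * x r * x s * q) (N r + N s)) *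
  \prod_r (efact (b * x r) W / (efact (a * x r * q / c) (N r) * (efact (a * x r * q / d) (N r) *
   (efact (b * c * d * x r / a) (N r) * 1)))).

(** The parameter a^2 q / (b c d) contributes the numerator factor a^2 x q /
    (b c d) and, through a x q / e = b c d x / a, the third denominator factor
    of alpha. *)
Lemma unary_link r j : (j <= N r)%N -> (N r <= W)%N ->
  efact (b * q ^+ (W - N r) / (a * x r)) (N r - j) * efact (b * x r) (W + j) *
  (th (a * x r ^+ 2 * q ^+ (2 * j)) / th (a * x r ^+ 2)) *
  ((efact (a ^+ 2 * x r * q / (b * c * d)) j * (efact (c * x r) j * (efact (d * x r) j * 1))) /
   (efact (a * x r * q / c) j * (efact (a * x r * q / d) j * (efact (b * c * d * x r / a) j * 1)))) *
  x r ^- j =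
  efact (b * x r) W / (efact (a * x r * q / c) (N r) * (efact (a * x r * q / d) (N r) *
   (efact (b * c * d * x r / a) (N r) * 1))) *
  (site_factor th q a (b * q ^+ W) d e (x r) (N r) j * param_factor th q a c (x r) (N r) j).
Proof.
move=> jN NW; have := hN r.
rewrite /site_factor /param_factor !mulr1 -{1 2 3}(subnKC jN).
have qn := qexp_neq0 q0.
have e1 : b * q ^+ W / q ^+ N r / (a * x r) = b * q ^+ (W - N r) / (a * x r).
  rewrite -{1}(subnK NW) exprD; congr (_ / _); by rewrite !mulrA mulfK.
have e2 : a ^+ 2 * x r * q / (b * c * d) = e * x r by rewrite /e; ring.
have e3 u : a * q ^+ j.+1 * x r / u = a * x r * q / u * q ^+ j by rewrite exprS; ring.
have e4 : a * q ^+ j.+1 * x r / e = b * c * d * x r / a * q ^+ j.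
  by rewrite exprS /e; field; rewrite a0 b0 c0 d0 q0.
have e5 : b * q ^+ W * x r = b * x r * q ^+ W by ring.
rewrite e1 e2 e4 !e3 e5 -[in X in _ -> X](subnKC jN) !efactD.
have -> : (j + (N r - j) - j = N r - j)%N by lia.
set B1 := efact _ (N r - j); set B2 := efact (b * x r) W; set B3 := efact _ j.
set t := th _ / th _; set v := x r ^- j.
rewrite !mulf_eq0 !negb_or => /and3P[/andP[n1 n2] /andP[n3 n4] /andP[n5 n6]].
by field; rewrite n1 n2 n3 n4 n5 n6.
Qed.

Lemma summand_link (j : 'I_n -> nat) : (forall r, (j r <= N r)%N) ->
  (\prod_(r < n) \prod_(s < n | (r < s)%N) efact (a * x r * x s * q) (N r + N s)) *
  (\prod_r (efact (b * q ^+ (W - N r) / (a * x r)) (N r - j r) * efact (b * x r) (W + j r))) /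
  (\prod_(r < n) \prod_(s < n) (efact (q ^+ (j r).+1 / q ^+ j s * x r / x s) (N r - j r) *
     efact (a * x r * x s * q) (N s + j r))) *
  ((\prod_(r < n) \prod_(s < n | (r < s)%N) (th (a * x r * x s * q ^+ (j r + j s)) / th (a * x r * x s))) *
   (\prod_r (th (a * x r ^+ 2 * q ^+ (2 * j r)) / th (a * x r ^+ 2))) *
   (b / a) ^+ weight j *
   q ^+ (\sum_(r < n) \sum_(s < n | (r < s)%N) j r * j s)%N *
   (\prod_(r < n) \prod_(s < n) (efact (a * x r * x s) (j r) / efact (q * x r / x s) (j r))) *
   (\prod_r ((efact (a ^+ 2 * x r * q / (b * c * d)) (j r) * (efact (c * x r) (j r) * (efact (d * x r) (j r) * 1))) /
     (efact (a * x r * q / c) (j r) * (efact (a * x r * q / d) (j r) * (efact (b * c * d * x r / a) (j r) * 1))))) *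
   (\prod_r x r ^- j r)) = link_const * summand th q a x N b c d e j.
Proof.
move=> jN; have NW r : (N r <= W)%N by rewrite /W /weight (bigD1 r) //= leq_addr.
have U : \prod_r (efact (b * x r) W / (efact (a * x r * q / c) (N r) * (efact (a * x r * q / d) (N r) *
   (efact (b * c * d * x r / a) (N r) * 1)))) *
   \prod_r (site_factor th q a (b * q ^+ W) d e (x r) (N r) (j r) * param_factor th q a c (x r) (N r) (j r)) =
   \prod_r (efact (b * q ^+ (W - N r) / (a * x r)) (N r - j r) * efact (b * x r) (W + j r)) *
   \prod_r (th (a * x r ^+ 2 * q ^+ (2 * j r)) / th (a * x r ^+ 2)) *
   (\prod_r ((efact (a ^+ 2 * x r * q / (b * c * d)) (j r) * (efact (c * x r) (j r) * (efact (d * x r) (j r) * 1))) /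
     (efact (a * x r * q / c) (j r) * (efact (a * x r * q / d) (j r) * (efact (b * c * d * x r / a) (j r) * 1))))) *
   (\prod_r x r ^- j r).
  rewrite -!big_split /=; apply: eq_bigr => r _; by rewrite -unary_link.
have S : \prod_(r < n) \prod_(s < n | (r < s)%N) pair_factor th q a (x r) (x s) (j r) (j s) =
   (\prod_(r < n) \prod_(s < n | (r < s)%N) (th (a * x r * x s * q ^+ (j r + j s)) / th (a * x r * x s))) *
   q ^+ (\sum_(r < n) \sum_(s < n | (r < s)%N) j r * j s)%N.
  rewrite -prodrXr -big_split /=; apply: eq_bigr => r _.
  by rewrite -prodrXr -big_split.
have O : \prod_(r < n) \prod_(s < n) ordered_factor th q a (x r) (x s) (N r) (N s) (j r) (j s) =
   (\prod_(r < n) \prod_(s < n) (efact (a * x r * x s) (j r) / efact (q * x r / x s) (j r))) /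
   (\prod_(r < n) \prod_(s < n) (efact (q ^+ (j r).+1 / q ^+ j s * x r / x s) (N r - j r) *
     efact (a * x r * x s * q) (N s + j r))).
  rewrite -prodfV -big_split /=; apply: eq_bigr => r _.
  rewrite -prodfV -big_split /=; apply: eq_bigr => s _.
  by rewrite /ordered_factor -(mulrA (efact (q * x r / x s) _)) invfM mulrA.
rewrite /link_const /summand -/W S O; move: U.
set P1 := \prod_r (efact _ W / _); set P2 := \prod_r (site_factor _ _ _ _ _ _ _ _ _ * _).
set U1 := \prod_r (efact _ _ * efact _ _); set T2 := \prod_r (th _ / _).
set Z := \prod_r (efact _ _ * _ / _); set X := \prod_r x r ^- _.
set Q := \prod_(r < n) \prod_(s < n | _) efact _ _.
set V := \prod_(r < n) \prod_(s < n) (efact _ _ * _).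
set T1 := \prod_(r < n) \prod_(s < n | _) (_ / _).
set WZ := \prod_(r < n) \prod_(s < n) (_ / _); set qq := q ^+ _; set bb := (b / a) ^+ _.
move=> U; transitivity (Q * bb * (U1 * T2 * Z * X) * T1 * qq * WZ / V); first by ring.
by rewrite -U; ring.
Qed.

Lemma rhs_link :
  (\prod_(r < n) \prod_(s < n | (r < s)%N) efact (a * x r * x s * q) (N r + N s)) != 0 ->
  (efact (b * c / a) W * (efact (b * d / a) W * (efact (a * q / (c * d)) W * 1)) *
    \prod_r efact (b * x r) W) /
  ((\prod_(r < n) \prod_(s < n) efact (q * x r / x s) (N r)) *
   \prod_r (efact (b * c * d * x r / a) (N r) * (efact (a * x r * q / c) (N r) *
     (efact (a * x r * q / d) (N r) * 1)))) = link_const * box_value th q a x N c d e.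
Proof.
move=> n0; rewrite /link_const /box_value /box_norm -/W.
have -> : a * q / (d * e) = b * c / a by rewrite /e; field; rewrite a0 b0 c0 d0 q0.
have -> : a * q / (c * e) = b * d / a by rewrite /e; field; rewrite a0 b0 c0 d0 q0.
have -> : \prod_r (efact (b * x r) W / (efact (a * x r * q / c) (N r) * (efact (a * x r * q / d) (N r) *
   (efact (b * c * d * x r / a) (N r) * 1)))) = (\prod_r efact (b * x r) W) /
   \prod_r (efact (a * x r * q / c) (N r) * (efact (a * x r * q / d) (N r) *
   (efact (b * c * d * x r / a) (N r) * 1))).
  by rewrite -prodfV -big_split.
have -> : \prod_r (efact (b * c * d * x r / a) (N r) * (efact (a * x r * q / c) (N r) *
     (efact (a * x r * q / d) (N r) * 1))) =
  \prod_r (efact (a * x r * q / c) (N r) * (efact (a * x r * q / d) (N r) *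
   (efact (b * c * d * x r / a) (N r) * 1))).
  by apply: eq_bigr => r _; ring.
move: n0; set Q := \prod_(r < n) \prod_(s < n | _) _ => n0.
set D1 := \prod_(r < n) \prod_(s < n) _; set D2 := \prod_r (_ * _).
set Y := \prod_r efact _ _.
rewrite !mulr1 (invfM D1 D2) (invfM D1 Q).
transitivity (Q / Q * (efact (b * c / a) W * (efact (b * d / a) W * efact (a * q / (c * d)) W) * Y / D1 / D2)).
  by rewrite divff // mul1r; ring.
by ring.
Qed.
End Link.

(** The dependent product type indexing the Bailey sum, embedded into
    functions with a common bound. *)
Lemma sum_box (V : nmodType) (n M : nat) (N : 'I_n -> nat) (G : ('I_n -> nat) -> V) :
  (forall r, (N r <= M)%N) ->
  \sum_(j : {dffun forall r : 'I_n, 'I_(N r).+1}) G (fun r => j r : nat) =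
  \sum_(j : {ffun 'I_n -> 'I_M.+1} | below N j) G (natf j).
Proof.
move=> NM.
pose h (j : {dffun forall r : 'I_n, 'I_(N r).+1}) : {ffun 'I_n -> 'I_M.+1} :=
  [ffun r => inord (j r)].
pose h' (j : {ffun 'I_n -> 'I_M.+1}) : {dffun forall r : 'I_n, 'I_(N r).+1} :=
  [ffun r => inord (j r)].
have nfh j : natf (h j) = (fun r => j r : nat).
  apply: boolp.funext => r; rewrite /natf ffunE inordK // ltnS.
  by rewrite (leq_trans _ (NM r)) // -ltnS.
rewrite (reindex_onto h h') /=; last first.
  move=> j /forallP jN; apply/ffunP => r; rewrite !ffunE inordK ?ltnS; last exact: jN.
  exact: inord_val.
apply: eq_big => [j|j _]; last by rewrite nfh.
apply/esym/andP; split.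
  by apply/forallP => r; rewrite nfh -ltnS.
apply/eqP/ffunP => r; rewrite !ffunE; apply: val_inj; rewrite /= inordK.
  by rewrite inordK // ltnS (leq_trans _ (NM r)) // -ltnS.
by rewrite inordK // ltnS (leq_trans _ (NM r)) // -ltnS.
Qed.

Section Translate.
Variables (C : numFieldType) (n : nat) (q p : C) (x : 'I_n -> C).
Local Notation th := (fun y : C => theta y p).
Hypothesis q0 : q != 0.

Lemma qpfact_sub (y : C) k j : (j <= k)%N ->
  qpfact y q p (k%:Z - j%:Z) = efact th q y (k - j).
Proof. by move=> jk; rewrite subzn. Qed.

Lemma qpfacts3 (u v w : C) (k : nat) : qpfacts [:: u; v; w] q p k%:Z =
  efact th q u k * (efact th q v k * (efact th q w k * 1)).
Proof. by rewrite /qpfacts !big_cons big_nil. Qed.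

Lemma expz_shift j k : q ^ (1 + j%:Z - k%:Z) = q ^+ j.+1 / q ^+ k.
Proof. by rewrite expfzDr // -invr_expz. Qed.

Lemma B5_alpha5 (a b c d : C) (N j : 'I_n -> nat) :
  a != 0 -> b != 0 -> c != 0 -> d != 0 -> (forall r, x r != 0) ->
  (forall r, (j r <= N r)%N) ->
  (forall r m, qpfacts [:: a * x r * q / c; a * x r * q / d; b * c * d * x r / a]
       q p m%:Z != 0) ->
  B5 q p x a b N j * alpha5 q p x c d a b j =
  link_const th q a b c d x N * summand th q a x N b c d (a ^+ 2 * q / (b * c * d)) j.
Proof.
move=> a0 b0 c0 d0 x0 jN hden.
have hN r : efact th q (a * x r * q / c) (N r) * (efact th q (a * x r * q / d) (N r) *
   (efact th q (b * c * d * x r / a) (N r) * 1)) != 0 by have := hden r (N r); rewrite qpfacts3.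
rewrite -(summand_link q0 a0 b0 c0 d0 hN jN) /B5 /alpha5.
congr (_ * _ / _ * (_ * _ * _ * _ * _ * _ * _)).
- by apply: eq_bigr => r _; rewrite qpfact_sub.
- apply: eq_bigr => r _; apply: eq_bigr => s _.
  by rewrite qpfact_sub // expz_shift.
- by apply: eq_bigr => r _; rewrite !qpfacts3.
Qed.

Lemma beta5_rhs (a b c d : C) (N : 'I_n -> nat) :
  a != 0 -> b != 0 -> c != 0 -> d != 0 ->
  (forall r s m, qpfact (a * x r * x s * q) q p m%:Z != 0) ->
  beta5 q p x c d a b N =
  link_const th q a b c d x N * box_value th q a x N c d (a ^+ 2 * q / (b * c * d)).
Proof.
move=> a0 b0 c0 d0 hden.
rewrite -(rhs_link q0 a0 b0 c0 d0); last first.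
  by apply/prodf_neq0 => r _; apply/prodf_neq0 => s _; exact: hden.
rewrite /beta5 qpfacts3; congr (_ / (_ * _)).
by apply: eq_bigr => r _; rewrite qpfacts3.
Qed.

Lemma qpfact_factor (y : C) k m : (k < m)%N -> qpfact y q p m%:Z != 0 ->
  theta (y * q ^+ k) p != 0.
Proof. by move=> km /prodf_neq0/(_ (Ordinal km) isT). Qed.
End Translate.

Theorem theorem9p4 (R : realType) (n : nat) (q p a b c d : R[i])
    (x : 'I_n -> R[i]) :
  (1 <= n)%N ->
  `|p| < 1 ->
  (* all parameters are nonzero *)
  q != 0 -> a != 0 -> b != 0 -> c != 0 -> d != 0 -> (forall r, x r != 0) ->
  (* no denominator of alpha, of beta, or of an entry (k, j) of the matrix
     with j <= k componentwise vanishes *)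
  (forall r s : 'I_n, (r < s)%N -> theta (a * x r * x s) p != 0) ->
  (forall r : 'I_n, theta (a * x r ^+ 2) p != 0) ->
  (forall (r s : 'I_n) (m : nat), qpfact (q * x r / x s) q p m%:Z != 0) ->
  (forall (r : 'I_n) (m : nat),
     qpfacts [:: a * x r * q / c; a * x r * q / d; b * c * d * x r / a]
       q p m%:Z != 0) ->
  (forall (k j : 'I_n -> nat), (forall r, (j r <= k r)%N) ->
     forall r s : 'I_n,
       qpfact (q ^ (1 + (j r)%:Z - (j s)%:Z) * x r / x s) q p
         ((k r)%:Z - (j r)%:Z) != 0) ->
  (forall (r s : 'I_n) (m : nat), qpfact (a * x r * x s * q) q p m%:Z != 0) ->
  WP_Bailey_pair (B5 q p x a b) (alpha5 q p x c d a b) (beta5 q p x c d a b).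
Proof.
move=> n1 p1 q0 a0 b0 c0 d0 x0 tars tarr hqx hcd hB haq N.
have np1 : ComplexField.Normc.normc p < 1 by move: p1; rewrite norm_normc -ltcR.
have hA (r s : 'I_n) k : theta (a * x r * x s * q ^+ k) p != 0.
  case: k => [|k]; last by have := qpfact_factor (ltnSn k) (haq r s k.+1); rewrite exprS mulrA.
  rewrite mulr1; case: (ltngtP r s) => [rs|sr|/val_inj ->]; first exact: tars.
    by rewrite mulrAC; exact: tars.
  by rewrite -mulrA -expr2.
have hX (r s : 'I_n) k l : r != s -> theta (x r / x s * q ^+ k / q ^+ l) p != 0.
  (* The last factor of this factorial is theta(q^(k - l) x_r / x_s). *)
  move=> rs; pose j (t : 'I_n) : nat := if t == s then l.+1 else 0%N.
  pose K (t : 'I_n) : nat := if t == s then l.+1 else k.+1.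
  have jK t : (j t <= K t)%N by rewrite /j /K; case: eqP.
  have H : qpfact (q ^ (1 + 0%N%:Z - l.+1%:Z) * x r / x s) q p k.+1%:Z != 0.
    by have := hB K j jK r s; rewrite /j /K (negPf rs) eqxx [k.+1%:Z - _]subr0.
  have := qpfact_factor (ltnSn k) H; congr (theta _ p != 0).
  rewrite expz_shift // !exprS expr0; field; by rewrite x0 q0 qexp_neq0.
have hq k : theta (q * q ^+ k) p != 0.
  have := qpfact_factor (ltnSn k) (hqx (Ordinal n1) (Ordinal n1) k.+1).
  by rewrite mulfK.
have [A0 [A1 [g0 [g1 rank2]]]] := theta_rank2 np1.
pose e := a ^+ 2 * q / (b * c * d).
have e0 : e != 0 by rewrite !mulf_neq0 ?invr_neq0 ?mulf_neq0 ?expf_neq0.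
have bal : b * c * d * e = a ^+ 2 * q by rewrite /e mulrC divfK // !mulf_neq0.
have NM r : (N r <= weight N)%N by rewrite /weight (bigD1 r) //= leq_addr.
have sqrtR (t : R[i]) : exists s, s ^+ 2 = t by exists (sqrtC t); exact: sqrtCK.
have I := box_formula_all q0 a0 x0 (theta1 p) (thetaV np1) rank2 sqrtR
  (fun u u0 => theta_generic np1 q0 u0 hq) hA hX hq (leqnn (weight N)) NM b0 c0 d0 e0 bal.
rewrite beta5_rhs // -/e -I /box_sum mulr_sumr.
rewrite -(sum_box (fun j => link_const (fun y : R[i] => theta y p) q a b c d x N * summand (fun y : R[i] => theta y p) q a x N b c d e j) NM).
by apply: eq_bigr => j _; rewrite B5_alpha5 // => r; rewrite -ltnS.
Qed.
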